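(* Let $d\ge l\ge 3$. Every $d$-uniform hypergraph $H$ on $n$ vertices that is piecewise linearly embeddable into $\mathbb{R}^{2d-l}$ (in particular every $H\in\mathcal{E}_{2d-l,d}$ on $n$ vertices) satisfies \[\chi^{\mathsf{w}}(H)\le\left\lceil (ed)^{\frac{1}{d-1}}\, n^{\,1-\frac{3^{l-1-d}}{d-1}}\right\rceil .\] In particular $\chi^{\mathsf{w}}_{2d-l,d}(n)=\mathcal{O}\bigl(n^{1-3^{l-1-d}/(d-1)}\bigr)$.
   Context: A $k$-uniform hypergraph $H=(V,E)$ consists of a finite set $V$ and $E\subseteq\binom{V}{k}$. A (linear) embedding of $H$ into $\mathbb{R}^d$ is a map $\phi:V(H)\to\mathbb{R}^d$ with $\dim\operatorname{aff}\phi(e)=k-1$ for every edge $e$ and $\operatorname{conv}\phi(e_1)\cap\operatorname{conv}\phi(e_2)=\operatorname{conv}\phi(e_1\cap e_2)$ for all edges $e_1,e_2$; $\mathcal{E}_{d,k}$ is the set of $k$-uniform hypergraphs admitting one. Every $k$-uniform hypergraph admits a linear embedding $\phi$ into $\mathbb{R}^{2k-1}$; with $\phi(H)=\bigcup_{e}\operatorname{conv}\phi(e)$, a piecewise linear embedding of $H$ into $\mathbb{R}^d$ is a map $\psi:\phi(H)\to\mathbb{R}^d$ that is a homeomorphism onto its image and is affine on each simplex of some subdivision of $\phi(H)$. A weak $c$-coloring of $H$ is a map $\kappa:V(H)\to\{1,\dots,c\}$ with $|\kappa(e)|>1$ for every edge $e$; $\chi^{\mathsf{w}}(H)$ is the least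 such $c$. $\chi^{\mathsf{w}}_{d,k}(n)=\max\{\chi^{\mathsf{w}}(H): H\in\mathcal{E}_{d,k},\ |V(H)|=n\}$. Here $e$ denotes Euler's number. *)

(* Defs.v *)
From Stdlib Require Import Reals List Arith Lia.
Import ListNotations.
Open Scope R_scope.

(** Points of R^m are represented as functions [nat -> R]; only the
    coordinates [i < m] are ever looked at (all notions below respect
    equality on the first [m] coordinates). *)
Definition pt := nat -> R.

Fixpoint rsum (n : nat) (f : nat -> R) : R :=
  match n with
  | O => 0
  | S k => rsum k f + f k
  end.

Definition veq (m : nat) (x y : pt) : Prop := forall i, (i < m)%nat -> x i = y i.

Definition dist (m : nat) (x y : pt) : R :=
  sqrt (rsum m (fun i => (x i - y i) ^ 2)).

Definition conv (m : nat) (S : list pt) (x : pt) : Prop :=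
  exists lam : nat -> R,
    (forall i, (i < length S)%nat -> 0 <= lam i) /\
    rsum (length S) lam = 1 /\
    forall j, (j < m)%nat ->
      x j = rsum (length S) (fun i => lam i * nth i S (fun _ => 0) j).

Definition aff_indep (m : nat) (P : list pt) : Prop :=
  forall mu : nat -> R,
    rsum (length P) mu = 0 ->
    (forall j, (j < m)%nat -> rsum (length P) (fun i => mu i * nth i P (fun _ => 0) j) = 0) ->
    forall i, (i < length P)%nat -> mu i = 0.

Definition uniform_hypergraph (k n : nat) (E : list (list nat)) : Prop :=
  forall e, In e E -> NoDup e /\ length e = k /\ forall v, In v e -> (v < n)%nat.

Definition linter (e1 e2 : list nat) : list nat :=
  filter (fun v => if in_dec Nat.eq_dec v e2 then true else false) e1.

Definition lin_embedding (m : nat) (E : list (list nat)) (phi : nat -> pt) : Prop :=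
  (forall e, In e E -> aff_indep m (map phi e)) /\
  (forall e1 e2, In e1 E -> In e2 E -> forall x,
      (conv m (map phi e1) x /\ conv m (map phi e2) x) <->
      conv m (map phi (linter e1 e2)) x).

Definition realization (m : nat) (E : list (list nat)) (phi : nat -> pt) (x : pt) : Prop :=
  exists e, In e E /\ conv m (map phi e) x.

Definition vin (m : nat) (p : pt) (s : list pt) : Prop :=
  exists q, In q s /\ veq m p q.

(** T (a finite list of geometric simplices, given by their vertex lists)
    is a subdivision of phi(H) in R^m: it is a geometric simplicial complex
    (simplices affinely independent, any two meet in a common face) whose
    union is phi(H) and each of whose simplices lies in a simplex of phi(H). *)
Definition subdivision (m : nat) (E : list (list nat)) (phi : nat -> pt)
    (T : list (list pt)) : Prop :=
  (forall s, In s T -> aff_indep m s /\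
      exists e, In e E /\ forall x, conv m s x -> conv m (map phi e) x) /\
  (forall s t, In s T -> In t T -> exists r : list pt,
      (forall p, In p r -> vin m p s /\ vin m p t) /\
      forall x, (conv m s x /\ conv m t x) <-> conv m r x) /\
  (forall x, realization m E phi x <-> exists s, In s T /\ conv m s x).

Definition PL_embedding (m D : nat) (E : list (list nat)) (phi : nat -> pt)
    (psi : pt -> pt) : Prop :=
  (exists T, subdivision m E phi T /\
     forall s, In s T -> exists (M : nat -> nat -> R) (b : pt),
       forall x, conv m s x -> forall j, (j < D)%nat ->
         psi x j = b j + rsum m (fun i => M j i * x i)) /\
  (forall x y, realization m E phi x -> realization m E phi y ->
     veq D (psi x) (psi y) -> veq m x y) /\
  (forall x, realization m E phi x -> forall eps, 0 < eps -> exists del, 0 < del /\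
     forall y, realization m E phi y -> dist m x y < del -> dist D (psi x) (psi y) < eps) /\
  (forall x, realization m E phi x -> forall eps, 0 < eps -> exists del, 0 < del /\
     forall y, realization m E phi y -> dist D (psi x) (psi y) < del -> dist m x y < eps).

Definition PL_embeddable (D k : nat) (E : list (list nat)) : Prop :=
  exists phi : nat -> pt, lin_embedding (2 * k - 1) E phi /\
    exists psi, PL_embedding (2 * k - 1) D E phi psi.

Definition weak_coloring (n : nat) (E : list (list nat)) (c : nat) (kappa : nat -> nat) : Prop :=
  (forall v, (v < n)%nat -> (1 <= kappa v <= c)%nat) /\
  (forall e, In e E -> exists u w, In u e /\ In w e /\ kappa u <> kappa w).

Definition Rceil (x : R) : Z := (- Int_part (- x))%Z.

(* Main.v *)
(** Suppose the vertices b_1, ..., b_(l-2) and three-element sets A_1, ..., A_k with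
    k = d - l + 2 span a subhypergraph of H in which every choice of one vertex
    per A_i, together with all the b_j, is an edge. Its complex is the join of k
    three-point sets and a simplex, and the deleted join of this complex is a sphere of
    dimension 2k + l - 3 = (2d - l) + 1; by the Borsuk-Ulam theorem it does not embed
    in R^(2d-l). The Borsuk-Ulam theorem follows from Fan's lemma, proved with mod 2
    chains on iterated barycentric subdivisions of the cross-polytope.

    Hence no vertex link of H contains the corresponding configuration, and
    Erdos' theorem bounds the number of ordered tuples in a link by
    4 n^(d - 1 - 3^(l-1-d)). Instead of the local lemma we use Rosenfeld's
    counting argument: if Delta is the maximal degree and
    c^(d-1) >= (d-1) ((d-1)/(d-2))^(d-2) Delta, each new vertex multiplies the number of
    proper c-colorings by at least c (d-2)/(d-1). Its constant is better than that of
    the local lemma; together with the (d-1)! orderings of an edge of a link, this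
    makes up for the 4 in Erdos' bound. *)

Require Import Defs.
From Stdlib Require Import Reals List Arith Lia Lra Bool ZArith.
From Stdlib Require Import Classical IndefiniteDescription FunctionalExtensionality.
Import ListNotations.
Open Scope R_scope.

(** * Chains modulo 2 *)

(** The deleted join is never built as a complex. An odd piecewise linear map sends the points of
    R^(D+2), D = 2d - l, to signed weights; the positive and the negative part of such a weight,
    normalized, are two points of the join with disjoint supports. A map of the join to R^D thus
    yields D + 1 odd functions on a sphere of dimension D + 1: the difference of the two masses and
    D damped differences of images. A common zero with nonzero masses is a collision of two
    disjointly supported points.

    Fan's lemma is used because the parity of the positive alternating simplices passes from a
    sphere to its equator. This needs no incidence structure of the triangulation, only that
    subdivision commutes with the boundary and with the antipode.

    The exponent comes from the induction for Erdos' theorem: every block but one cubes the saved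
    factor n^eps, and the last power n^(3^(k-1) eps) must not exceed n. The vertices b_j cost
    nothing: one is the center of the link, the others are fixed by averaging. *)

Definition parity {A : Type} (f : A -> bool) (c : list A) : bool :=
  fold_right (fun t b => xorb (f t) b) false c.

Lemma parity_app {A} (f : A -> bool) c c' :
  parity f (c ++ c') = xorb (parity f c) (parity f c').
Proof.
  induction c as [|t c IH]; simpl; [now destruct (parity f c')|].
  now rewrite IH, xorb_assoc_reverse.
Qed.

Lemma parity_map {A B} (g : A -> B) (f : B -> bool) c :
  parity f (map g c) = parity (fun t => f (g t)) c.
Proof. induction c as [|t c IH]; simpl; [easy|now rewrite IH]. Qed.

Lemma parity_flat_map {A B} (g : A -> list B) (f : B -> bool) c :
  parity f (flat_map g c) = parity (fun t => parity f (g t)) c.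
Proof.
  induction c as [|t c IH]; simpl; [easy|].
  now rewrite parity_app, IH.
Qed.

Lemma parity_ext {A} (f g : A -> bool) c :
  (forall t, In t c -> f t = g t) -> parity f c = parity g c.
Proof.
  induction c as [|t c IH]; simpl; intros H; [easy|].
  rewrite (H t), IH; auto.
Qed.

Lemma parity_xor {A} (f g : A -> bool) c :
  parity (fun t => xorb (f t) (g t)) c = xorb (parity f c) (parity g c).
Proof.
  induction c as [|t c IH]; simpl; [easy|]. rewrite IH.
  destruct (f t), (g t), (parity f c), (parity g c); reflexivity.
Qed.

Lemma parity_false {A} (f : A -> bool) c :
  (forall t, In t c -> f t = false) -> parity f c = false.
Proof.
  induction c as [|t c IH]; simpl; intros H; [easy|].
  rewrite (H t), IH; auto.
Qed.

(** A list of tuples is read as the mod 2 chain which is the sum of its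
    members; two lists represent the same chain when no functional
    separates them. *)
Definition chain_eq {A : Type} (c c' : list A) : Prop :=
  forall f, parity f c = parity f c'.

Lemma chain_eq_flat_map {A B} (g : A -> list B) c c' :
  chain_eq c c' -> chain_eq (flat_map g c) (flat_map g c').
Proof. intros H f. rewrite !parity_flat_map. apply H. Qed.

(** Modulo 2 no signs are needed. Tuples keep their order and may repeat entries, so that the
    boundary of a boundary vanishes without any assumption of nondegeneracy. *)
Fixpoint faces {A : Type} (t : list A) : list (list A) :=
  match t with
  | [] => []
  | x :: t' => t' :: map (cons x) (faces t')
  end.

Lemma faces_length {A} (t t' : list A) : In t' (faces t) -> length t = S (length t').
Proof.
  revert t'; induction t as [|x t IH]; simpl; [easy|].
  intros t' [<-|H]; [easy|].
  apply in_map_iff in H as (u & <- & Hu). simpl. now rewrite (IH u).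
Qed.

Lemma faces_incl {A} (t t' : list A) : In t' (faces t) -> incl t' t.
Proof.
  revert t'; induction t as [|x t IH]; simpl; [easy|].
  intros t' [<-|H] y Hy; [now right|].
  apply in_map_iff in H as (u & <- & Hu). destruct Hy as [->|Hy]; [now left|].
  right. now apply (IH u).
Qed.

Lemma faces_map {A B} (g : A -> B) t : faces (map g t) = map (map g) (faces t).
Proof.
  induction t as [|x t IH]; simpl; [easy|].
  rewrite IH, !map_map. reflexivity.
Qed.

Lemma parity_faces_cone {A} (f : list A -> bool) x c :
  parity f (flat_map faces (map (cons x) c)) =
  xorb (parity f c) (parity (fun t => f (x :: t)) (flat_map faces c)).
Proof.
  rewrite !parity_flat_map, parity_map, <- parity_xor.
  apply parity_ext; intros t _. simpl. now rewrite parity_map.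
Qed.

Lemma faces_faces {A} (f : list A -> bool) t :
  parity f (flat_map faces (faces t)) = false.
Proof.
  revert f; induction t as [|x t IH]; intros f; simpl; [easy|].
  rewrite parity_app, parity_faces_cone, IH.
  now destruct (parity f (faces t)).
Qed.

(** * Barycentric subdivision *)

Definition coord_sum (t : list pt) (j : nat) : R := fold_right (fun p a => p j + a) 0 t.

Definition barycenter (t : list pt) : pt := fun j => coord_sum t j / INR (length t).

(** Only meaningful on tuples of length [n]. *)
Fixpoint sd (n : nat) (t : list pt) : list (list pt) :=
  match n with
  | O => [[]]
  | S n' => map (cons (barycenter t)) (flat_map (sd n') (faces t))
  end.

Fixpoint sd_iter (N n : nat) (c : list (list pt)) : list (list pt) :=
  match N with
  | O => c
  | S N' => flat_map (sd n) (sd_iter N' n c)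
  end.

Lemma sd_length n t t' : length t = n -> In t' (sd n t) -> length t' = n.
Proof.
  revert t t'; induction n as [|n IH]; intros t t' Ht; simpl.
  - now intros [<-|[]].
  - intros H. apply in_map_iff in H as (u & <- & Hu).
    apply in_flat_map in Hu as (v & Hv & Hu). simpl.
    rewrite (IH v u); [easy| |easy]. apply faces_length in Hv. lia.
Qed.

Lemma sd_iter_length N n c t :
  (forall t, In t c -> length t = n) -> In t (sd_iter N n c) -> length t = n.
Proof.
  intros Hc; revert t; induction N as [|N IH]; intros t; simpl; [apply Hc|].
  intros H. apply in_flat_map in H as (u & Hu & H).
  apply (sd_length n u); auto.
Qed.

(** [sd] cones the subdivided boundary from the barycenter. The base of this cone is the chain that
    is wanted; the cone over the boundary of the base vanishes, because by induction that boundary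
    is the subdivision of a boundary of a boundary. *)
Lemma parity_faces_sd n t f : length t = n ->
  parity f (flat_map faces (sd n t)) = parity f (flat_map (sd (n - 1)) (faces t)).
Proof.
  revert t f; induction n as [|n IH]; intros t f Ht.
  - destruct t; easy.
  - cbn [sd]. rewrite parity_faces_cone. replace (S n - 1)%nat with n by lia.
    set (g := fun u : list pt => f (barycenter t :: u)).
    assert (E : parity g (flat_map faces (flat_map (sd n) (faces t))) = false).
    { rewrite parity_flat_map, parity_flat_map.
      rewrite (parity_ext _ (fun u => parity g (flat_map (sd (n - 1)) (faces u)))).
      - rewrite <- (faces_faces (fun u => parity g (sd (n - 1) u)) t), parity_flat_map.
        apply parity_ext; intros u _. now rewrite parity_flat_map.
      - intros u Hu. apply faces_length in Hu.
        rewrite <- (IH u g) by lia. now rewrite parity_flat_map. }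
    rewrite E. now destruct (parity f _).
Qed.

Lemma chain_eq_faces_sd_iter N n c : (forall t, In t c -> length t = n) ->
  chain_eq (flat_map faces (sd_iter N n c)) (sd_iter N (n - 1) (flat_map faces c)).
Proof.
  intros Hc; induction N as [|N IH]; intros f; simpl; [easy|].
  rewrite <- (chain_eq_flat_map _ _ _ IH f).
  rewrite !parity_flat_map. apply parity_ext; intros t Ht.
  rewrite <- !parity_flat_map. apply parity_faces_sd.
  now apply (sd_iter_length N n c).
Qed.

Lemma chain_eq_sd_iter N n c c' :
  chain_eq c c' -> chain_eq (sd_iter N n c) (sd_iter N n c').
Proof. intros H; induction N; simpl; auto using chain_eq_flat_map. Qed.

Lemma sd_iter_app N n c c' : sd_iter N n (c ++ c') = sd_iter N n c ++ sd_iter N n c'.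
Proof. induction N as [|N IH]; simpl; [easy|]. now rewrite IH, flat_map_app. Qed.

Definition antipode (p : pt) : pt := fun j => - p j.

Lemma antipode_involutive p : antipode (antipode p) = p.
Proof. apply functional_extensionality; intros j; unfold antipode; ring. Qed.

Lemma barycenter_antipode t : barycenter (map antipode t) = antipode (barycenter t).
Proof.
  apply functional_extensionality; intros j.
  assert (E : coord_sum (map antipode t) j = - coord_sum t j).
  { induction t as [|p t IH]; simpl; [ring|]. rewrite IH. unfold antipode. ring. }
  unfold barycenter. rewrite length_map, E. unfold antipode, Rdiv. ring.
Qed.

Lemma flat_map_map_map {A B} (g : A -> A) (h : A -> list B) (g' : B -> B) c :
  (forall t, h (g t) = map g' (h t)) -> flat_map h (map g c) = map g' (flat_map h c).
Proof.
  intros H; induction c as [|t c IH]; simpl; [easy|].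
  now rewrite IH, H, map_app.
Qed.

Lemma sd_antipode n t : sd n (map antipode t) = map (map antipode) (sd n t).
Proof.
  revert t; induction n as [|n IH]; intros t; simpl; [easy|].
  rewrite faces_map, (flat_map_map_map _ _ (map antipode)) by easy.
  rewrite barycenter_antipode, !map_map. reflexivity.
Qed.

Lemma sd_iter_antipode N n c :
  sd_iter N n (map (map antipode) c) = map (map antipode) (sd_iter N n c).
Proof.
  induction N as [|N IH]; simpl; [easy|].
  rewrite IH. apply flat_map_map_map. apply sd_antipode.
Qed.

(** The form in which convexity enters, both for the interval around a coordinate of a barycenter
    and for a facet of the cross-polytope. *)
Lemma sd_closed (Q : pt -> Prop) :
  (forall t, t <> [] -> (forall p, In p t -> Q p) -> Q (barycenter t)) ->
  forall n t t', length t = n -> (forall p, In p t -> Q p) ->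
  In t' (sd n t) -> forall p, In p t' -> Q p.
Proof.
  intros HQ; induction n as [|n IH]; intros t t' Ht Hp; simpl.
  - intros [<-|[]] p [].
  - intros H. apply in_map_iff in H as (u & <- & Hu).
    apply in_flat_map in Hu as (v & Hv & Hu).
    intros p [<-|Hpu].
    + apply HQ; auto. intros ->; discriminate.
    + apply (IH v u); auto.
      * apply faces_length in Hv; lia.
      * intros q Hq. apply Hp. now apply (faces_incl t v).
Qed.

Lemma coord_sum_bounds a b j (t : list pt) : (forall p, In p t -> a <= p j <= b) ->
  a * INR (length t) <= coord_sum t j <= b * INR (length t).
Proof.
  induction t as [|p t IH]; intros H; [simpl; lra|].
  change (length (p :: t)) with (S (length t)). rewrite S_INR.
  specialize (IH (fun q Hq => H q (or_intror Hq))).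
  pose proof (H p (or_introl eq_refl)). simpl. lra.
Qed.

Lemma length_pos {A} (t : list A) : t <> [] -> 0 < INR (length t).
Proof. destruct t; [easy|]. intros _. apply lt_0_INR. simpl; lia. Qed.

Lemma barycenter_bounds a b j (t : list pt) : t <> [] -> (forall p, In p t -> a <= p j <= b) ->
  a <= barycenter t j <= b.
Proof.
  intros Ht H. apply coord_sum_bounds in H. apply length_pos in Ht.
  unfold barycenter. split.
  - apply Rmult_le_reg_r with (INR (length t)); [easy|].
    unfold Rdiv. rewrite Rmult_assoc, Rinv_l; lra.
  - apply Rmult_le_reg_r with (INR (length t)); [easy|].
    unfold Rdiv. rewrite Rmult_assoc, Rinv_l; lra.
Qed.

(** The summand of [p] itself vanishes, which leaves [length t - 1] terms; divided by [length t]
    this is the contraction of the mesh. *)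
Lemma coord_sum_vertex_dist delta j (t : list pt) (p : pt) : In p t ->
  (forall q, In q t -> Rabs (q j - p j) <= delta) ->
  Rabs (coord_sum t j - INR (length t) * p j) <= (INR (length t) - 1) * delta.
Proof.
  intros Hp Hd.
  assert (G : forall u, (forall q, In q u -> Rabs (q j - p j) <= delta) ->
    Rabs (coord_sum u j - INR (length u) * p j) <= INR (length u) * delta).
  { induction u as [|q u IH]; intros Hu.
    - simpl. rewrite Rmult_0_l, Rminus_0_r, Rabs_R0; lra.
    - change (length (q :: u)) with (S (length u)). rewrite S_INR. simpl.
      replace (q j + coord_sum u j - (INR (length u) + 1) * p j)
        with ((q j - p j) + (coord_sum u j - INR (length u) * p j)) by ring.
      eapply Rle_trans; [apply Rabs_triang|].
      specialize (IH (fun r Hr => Hu r (or_intror Hr))).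
      pose proof (Hu q (or_introl eq_refl)). lra. }
  apply in_split in Hp as (t1 & t2 & ->).
  assert (E : forall u v, coord_sum (u ++ v) j = coord_sum u j + coord_sum v j).
  { induction u as [|q u IH]; intros v; simpl; [ring|]. rewrite IH. ring. }
  rewrite E. simpl coord_sum at 2. rewrite length_app, plus_INR.
  change (length (p :: t2)) with (S (length t2)). rewrite S_INR.
  specialize (G (t1 ++ t2)). rewrite E, length_app, plus_INR in G.
  replace (coord_sum t1 j + (p j + coord_sum t2 j) -
    (INR (length t1) + (INR (length t2) + 1)) * p j) with
    (coord_sum t1 j + coord_sum t2 j - (INR (length t1) + INR (length t2)) * p j) by ring.
  eapply Rle_trans; [apply G|lra].
  intros q Hq. apply Hd. rewrite in_app_iff in *. simpl. tauto.
Qed.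

Lemma sd_mesh K j delta : (1 <= K)%nat -> 0 <= delta -> forall n (t : list pt) t', (n <= K)%nat ->
  length t = n ->
  (forall p q : pt, In p t -> In q t -> Rabs (p j - q j) <= delta) ->
  In t' (sd n t) ->
  forall p q, In p t' -> In q t' -> Rabs (p j - q j) <= (1 - / INR K) * delta.
Proof.
  intros HK Hdelta. assert (HK0 : 0 < INR K) by (apply lt_0_INR; lia).
  assert (HK1 : / INR K <= 1).
  { rewrite <- Rinv_1. apply Rinv_le_contravar; [lra|]. apply (le_INR 1); lia. }
  assert (Hbd : 0 <= (1 - / INR K) * delta) by (apply Rmult_le_pos; lra).
  induction n as [|n IH]; intros t t' Hn Ht Hd; simpl.
  - intros [<-|[]] p q [].
  - intros H. apply in_map_iff in H as (u & <- & Hu).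
    assert (Hne : t <> []) by (intros ->; discriminate).
    (* The barycenter is close to every vertex of [t] and hence, an interval being convex, to every
       vertex of the subdivided faces. Pairs without the new vertex are left to the induction. *)
    assert (Hb : forall p, In p u ->
       Rabs (p j - barycenter t j) <= (1 - / INR K) * delta).
    { assert (Hv : forall p, In p t ->
         Rabs (p j - barycenter t j) <= (1 - / INR K) * delta).
      { intros p Hp.
        pose proof (coord_sum_vertex_dist delta j t p Hp (fun q Hq => Hd q p Hq Hp)) as B.
        pose proof (length_pos t Hne) as Hl.
        rewrite Rabs_minus_sym.
        replace (barycenter t j - p j) with
          ((coord_sum t j - INR (length t) * p j) * / INR (length t))
          by (unfold barycenter; field; lra).
        rewrite Rabs_mult, (Rabs_right (/ _)) by (apply Rle_ge, Rlt_le, Rinv_0_lt_compat, Hl).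
        apply Rle_trans with ((INR (length t) - 1) * delta * / INR (length t)).
        - apply Rmult_le_compat_r; [apply Rlt_le, Rinv_0_lt_compat, Hl|exact B].
        - replace ((INR (length t) - 1) * delta * / INR (length t))
            with ((1 - / INR (length t)) * delta) by (field; lra).
          apply Rmult_le_compat_r; [easy|].
          assert (/ INR K <= / INR (length t)); [|lra].
          apply Rinv_le_contravar; [easy|]. apply le_INR. lia. }
      apply in_flat_map in Hu as (v & Hvf & Hu).
      intros p Hp.
      refine (sd_closed (fun p => Rabs (p j - barycenter t j) <= (1 - / INR K) * delta)
        _ n v u _ _ Hu p Hp).
      - intros w Hw Hall.
        assert (B : barycenter t j - (1 - / INR K) * delta <= barycenter w j
                    <= barycenter t j + (1 - / INR K) * delta).
        { apply barycenter_bounds; [easy|]. intros q Hq. specialize (Hall q Hq).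
          revert Hall; unfold Rabs; destruct Rcase_abs; lra. }
        apply Rabs_le. lra.
      - apply faces_length in Hvf; lia.
      - intros q Hq. apply Hv. now apply (faces_incl t v). }
    intros p q [<-|Hp] [<-|Hq].
    + now rewrite Rminus_diag, Rabs_R0.
    + rewrite Rabs_minus_sym. auto.
    + auto.
    + apply in_flat_map in Hu as (v & Hvf & Hu).
      apply (IH v u); auto; [lia|apply faces_length in Hvf; lia|].
      intros a b Ha Hb'. apply Hd; now apply (faces_incl t v).
Qed.

Lemma sd_iter_mesh K j N n (c : list (list pt)) : (1 <= K)%nat -> (n <= K)%nat ->
  (forall t, In t c -> length t = n) ->
  (forall t p q, In t c -> In p t -> In q t -> Rabs (p j - q j) <= 2) ->
  forall t p q, In t (sd_iter N n c) -> In p t -> In q t ->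
  Rabs (p j - q j) <= 2 * (1 - / INR K) ^ N.
Proof.
  intros HK Hn Hc Hd. assert (HK0 : 0 < INR K) by (apply lt_0_INR; lia).
  assert (HK1 : / INR K <= 1).
  { rewrite <- Rinv_1. apply Rinv_le_contravar; [lra|]. apply (le_INR 1); lia. }
  induction N as [|N IH]; intros t p q Ht Hp Hq; simpl in *.
  - rewrite Rmult_1_r. eauto.
  - apply in_flat_map in Ht as (u & Hu & Ht).
    replace (2 * ((1 - / INR K) * (1 - / INR K) ^ N)) with
      ((1 - / INR K) * (2 * (1 - / INR K) ^ N)) by ring.
    eapply (sd_mesh K j); eauto.
    + apply Rmult_le_pos; [lra|]. apply pow_le; lra.
    + now apply (sd_iter_length N n c).
Qed.

(** * Fan's lemma *)

(** A label is a pair (index, sign). A list of labels is alternating when its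
    indices are distinct and the signs alternate in the order of decreasing
    indices, the first of them being [s]; [m] bounds the indices. *)
Fixpoint alternating (m : nat) (s : bool) (L : list (nat * bool)) : bool :=
  match m with
  | O => match L with [] => true | _ => false end
  | S m' =>
      let rest := filter (fun x => negb (fst x =? m')%nat) L in
      match filter (fun x => (fst x =? m')%nat) L with
      | [] => alternating m' s rest
      | [x] => eqb (snd x) s && alternating m' (negb s) rest
      | _ => false
      end
  end.

Definition flip (x : nat * bool) : nat * bool := (fst x, negb (snd x)).

Lemma filter_flip (P : nat -> bool) L :
  filter (fun x => P (fst x)) (map flip L) = map flip (filter (fun x => P (fst x)) L).
Proof.
  induction L as [|x L IH]; simpl; [easy|].
  destruct (P (fst x)); simpl; now rewrite IH.
Qed.

Lemma alternating_flip m s L : alternating m s (map flip L) = alternating m (negb s) L.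
Proof.
  revert s L; induction m as [|m IH]; intros s L; simpl.
  - now destruct L.
  - rewrite (filter_flip (fun i => negb (i =? m)%nat)), (filter_flip (fun i => (i =? m)%nat)).
    destruct (filter (fun x => (fst x =? m)%nat) L) as [|x [|y T]]; simpl; rewrite ?IH; try easy.
    destruct (snd x), s; easy.
Qed.

Lemma alternating_length m s L : alternating m s L = true -> (length L <= m)%nat.
Proof.
  revert s L; induction m as [|m IH]; intros s L; simpl.
  - destruct L; simpl; [lia|discriminate].
  - rewrite <- (filter_length (fun x => (fst x =? m)%nat) L).
    destruct (filter (fun x => (fst x =? m)%nat) L) as [|x [|y T]]; simpl; try discriminate.
    + intros H. apply IH in H. lia.
    + rewrite andb_true_iff. intros [_ H]. apply IH in H. lia.
Qed.

(** A Leibniz rule: the deleted entry is either one selected by [P] or one of the others. *)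
Lemma parity_faces_filter {A} (P : A -> bool) (G : list A -> list A -> bool) L :
  parity (fun L' => G (filter P L') (filter (fun x => negb (P x)) L')) (faces L) =
  xorb (parity (fun T => G T (filter (fun x => negb (P x)) L)) (faces (filter P L)))
       (parity (G (filter P L)) (faces (filter (fun x => negb (P x)) L))).
Proof.
  revert G; induction L as [|x L IH]; intros G; simpl; [easy|].
  rewrite parity_map; simpl. destruct (P x) eqn:Ex; simpl.
  - rewrite (IH (fun T R => G (x :: T) R)), parity_map. now rewrite xorb_assoc.
  - rewrite (IH (fun T R => G T (x :: R))), parity_map.
    rewrite <- !xorb_assoc. f_equal. apply xorb_comm.
Qed.

(** In an alternating list, deleting the lowest index keeps the leading sign and deleting the
    highest reverses it; any other deletion leaves two neighbors of equal sign. In a list that does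
    not alternate, the alternating faces come in pairs. *)
Lemma alternating_faces m L :
  (forall x, In x L -> (fst x < m)%nat) ->
  (forall x y, In x L -> In y L -> fst x = fst y -> snd x = snd y) ->
  forall s, parity (alternating m s) (faces L) =
            xorb (alternating m s L) (alternating m (negb s) L).
Proof.
  revert L; induction m as [|m IH]; intros L Hm Hc s.
  - destruct L as [|x L]; [easy|]. specialize (Hm x (or_introl eq_refl)). lia.
  - set (P := fun x : nat * bool => (fst x =? m)%nat).
    set (G := fun (s : bool) (T R : list (nat * bool)) => match T with
      | [] => alternating m s R
      | [x] => eqb (snd x) s && alternating m (negb s) R
      | _ => false end).
    change (parity (fun L' => G s (filter P L') (filter (fun x => negb (P x)) L')) (faces L)
      = xorb (G s (filter P L) (filter (fun x => negb (P x)) L))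
             (G (negb s) (filter P L) (filter (fun x => negb (P x)) L))).
    rewrite parity_faces_filter.
    assert (HR : forall s, parity (alternating m s) (faces (filter (fun x => negb (P x)) L)) =
       xorb (alternating m s (filter (fun x => negb (P x)) L))
            (alternating m (negb s) (filter (fun x => negb (P x)) L))).
    { apply IH.
      - intros x Hx. apply filter_In in Hx as [Hx Hne]. specialize (Hm x Hx).
        unfold P in Hne. destruct (Nat.eqb_spec (fst x) m); [discriminate|lia].
      - intros x y Hx Hy. apply filter_In in Hx, Hy. now apply Hc. }
    assert (HT : forall x y, In x (filter P L) -> In y (filter P L) -> snd x = snd y).
    { intros x y Hx Hy. apply filter_In in Hx as [Hx Ex], Hy as [Hy Ey]. apply Hc; auto.
      apply Nat.eqb_eq in Ex, Ey. congruence. }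
    set (R := filter (fun x => negb (P x)) L) in *.
    destruct (filter P L) as [|x [|y [|z T]]].
    + simpl. rewrite <- HR. reflexivity.
    + change (xorb (xorb (alternating m s R) false)
          (parity (fun R => eqb (snd x) s && alternating m (negb s) R) (faces R)) =
        xorb (eqb (snd x) s && alternating m (negb s) R)
          (eqb (snd x) (negb s) && alternating m (negb (negb s)) R)).
      destruct (eqb (snd x) s) eqn:Ex.
      * rewrite (parity_ext _ (alternating m (negb s))) by easy. rewrite HR.
        apply eqb_prop in Ex. rewrite Ex, negb_involutive.
        destruct s; simpl; destruct (alternating m true R), (alternating m false R); reflexivity.
      * rewrite (parity_false (fun _ => false && _)) by easy.
        destruct (snd x), s; try discriminate; simpl;
        now rewrite ?xorb_false_r.
    (* Two top entries have the same sign, so that deleting one or the other contributes the same,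
       and the two cancel. *)
    + rewrite (parity_false (G s [x; y])) by easy.
      assert (E : snd x = snd y) by (apply HT; simpl; auto).
      simpl. rewrite E.
      destruct (eqb (snd y) s), (alternating m (negb s) R); reflexivity.
    + rewrite (parity_false (G s (x :: y :: z :: T))) by easy.
      rewrite parity_false; [easy|].
      intros T' HT'. apply faces_length in HT'. simpl in HT'.
      destruct T' as [|a [|b T']]; simpl in HT'; [lia|lia|easy].
Qed.

(** * Octahedral spheres and Tucker's lemma *)

Definition basis (i : nat) : pt := fun j => if (j =? i)%nat then 1 else 0.

(** The facets of the cross-polytope in R^i, built by suspension: each sphere is the equator of the
    next one. *)
Fixpoint octahedral (i : nat) : list (list pt) :=
  match i with
  | O => [[]]
  | S i' => map (cons (basis i')) (octahedral i') ++
            map (cons (antipode (basis i'))) (octahedral i')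
  end.

Lemma octahedral_length i t : In t (octahedral i) -> length t = i.
Proof.
  revert t; induction i as [|i IH]; intros t; simpl.
  - now intros [<-|[]].
  - rewrite in_app_iff, !in_map_iff.
    intros [(u & <- & Hu)|(u & <- & Hu)]; simpl; now rewrite (IH u).
Qed.

Lemma octahedral_antipode i : chain_eq (map (map antipode) (octahedral i)) (octahedral i).
Proof.
  induction i as [|i IH]; intros f; [easy|]. simpl.
  rewrite map_app, !map_map, !parity_app, !parity_map. simpl.
  rewrite antipode_involutive.
  pose proof (IH (fun t => f (basis i :: t))) as H1.
  pose proof (IH (fun t => f (antipode (basis i) :: t))) as H2.
  rewrite parity_map in H1, H2. rewrite H1, H2. apply xorb_comm.
Qed.

Lemma faces_octahedral i : chain_eq (flat_map faces (octahedral i)) [].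
Proof.
  induction i as [|i IH]; intros f; [easy|]. simpl octahedral.
  rewrite flat_map_app, parity_app, !parity_faces_cone, !IH.
  simpl. now destruct (parity f (octahedral i)).
Qed.

Lemma faces_hemisphere i :
  chain_eq (flat_map faces (map (cons (basis i)) (octahedral i))) (octahedral i).
Proof.
  intros f. rewrite parity_faces_cone, faces_octahedral. apply xorb_false_r.
Qed.

Lemma octahedral_hemispheres i :
  chain_eq (octahedral (S i))
    (map (cons (basis i)) (octahedral i) ++
     map (map antipode) (map (cons (basis i)) (octahedral i))).
Proof.
  intros f. simpl. rewrite !parity_app, !parity_map. f_equal.
  rewrite <- (octahedral_antipode i (fun t => f (antipode (basis i) :: t))), parity_map.
  reflexivity.
Qed.

(** The l1 sphere is the boundary of the cross-polytope, so that the vertices of the subdivisions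
    lie on it without any projection. *)
Definition on_sphere (M : nat) (p : pt) : Prop := rsum M (fun j => Rabs (p j)) = 1.

Lemma rsum_ext n f g : (forall i, (i < n)%nat -> f i = g i) -> rsum n f = rsum n g.
Proof. induction n; simpl; intros H; [easy|]. rewrite IHn, H; auto. Qed.

Lemma rsum_plus n f g : rsum n (fun i => f i + g i) = rsum n f + rsum n g.
Proof. induction n; simpl; [ring|]. rewrite IHn; ring. Qed.

Lemma rsum_scal n a f : rsum n (fun i => a * f i) = a * rsum n f.
Proof. induction n; simpl; [ring|]. rewrite IHn; ring. Qed.

Lemma rsum_zero n f : (forall i, (i < n)%nat -> f i = 0) -> rsum n f = 0.
Proof. induction n; simpl; intros H; [easy|]. rewrite IHn, H; auto; ring. Qed.

Lemma rsum_nonneg n f : (forall i, (i < n)%nat -> 0 <= f i) -> 0 <= rsum n f.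
Proof.
  induction n; simpl; intros H; [lra|].
  apply Rplus_le_le_0_compat; auto.
Qed.

Lemma rsum_ge_term n f i : (forall i, (i < n)%nat -> 0 <= f i) -> (i < n)%nat -> f i <= rsum n f.
Proof.
  induction n; simpl; intros H Hi; [lia|].
  destruct (Nat.eq_dec i n) as [->|].
  - pose proof (rsum_nonneg n f (fun i Hi => H i (Nat.lt_lt_succ_r _ _ Hi))). lra.
  - pose proof (H n (Nat.lt_succ_diag_r n)). specialize (IHn (fun i Hi => H i (Nat.lt_lt_succ_r _ _ Hi))).
    assert (f i <= rsum n f) by (apply IHn; lia). lra.
Qed.

Lemma rsum_delta n i a : (i < n)%nat ->
  rsum n (fun j => if (j =? i)%nat then a j else 0) = a i.
Proof.
  induction n; simpl; intros H; [lia|].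
  destruct (Nat.eqb_spec n i) as [->|].
  - rewrite rsum_zero; [ring|]. intros j Hj. destruct (Nat.eqb_spec j i); [lia|easy].
  - rewrite IHn; [ring|lia].
Qed.

(** On the orthant with signs [sg] the l1 norm is linear, which makes the facet stable under
    barycenters. *)
Definition in_facet (M : nat) (sg : nat -> R) (p : pt) : Prop :=
  (forall j, 0 <= sg j * p j) /\ rsum M (fun j => sg j * p j) = 1.

Lemma in_facet_on_sphere M sg p :
  (forall j, sg j = 1 \/ sg j = -1) -> in_facet M sg p -> on_sphere M p.
Proof.
  intros Hs [H0 H1]. unfold on_sphere. rewrite <- H1. apply rsum_ext. intros j _.
  specialize (H0 j). destruct (Hs j) as [E|E]; rewrite E in *;
  unfold Rabs; destruct Rcase_abs; lra.
Qed.

Lemma in_facet_barycenter M sg t : t <> [] -> (forall p, In p t -> in_facet M sg p) ->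
  in_facet M sg (barycenter t).
Proof.
  intros Hne H. pose proof (length_pos t Hne) as Hl. split.
  - intros j. unfold barycenter.
    assert (0 <= sg j * coord_sum t j).
    { clear Hne Hl. induction t as [|p t IH]; simpl; [lra|].
      destruct (H p (or_introl eq_refl)) as [H0 _]. specialize (H0 j).
      specialize (IH (fun q Hq => H q (or_intror Hq))). lra. }
    unfold Rdiv. rewrite <- Rmult_assoc. apply Rmult_le_pos; [easy|].
    now apply Rlt_le, Rinv_0_lt_compat.
  - assert (E : rsum M (fun j => sg j * coord_sum t j) = INR (length t)).
    { clear Hne Hl. induction t as [|p t IH].
      - simpl. apply rsum_zero. intros; ring.
      - change (length (p :: t)) with (S (length t)). rewrite S_INR, <- IH.
        + destruct (H p (or_introl eq_refl)) as [_ H1]. rewrite <- H1, Rplus_comm, <- rsum_plus.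
          apply rsum_ext. intros; simpl; ring.
        + intros q Hq. apply H; now right. }
    rewrite (rsum_ext _ _ (fun j => / INR (length t) * (sg j * coord_sum t j))).
    + rewrite rsum_scal, E. field. lra.
    + intros. unfold barycenter. field. lra.
Qed.

Lemma octahedral_facet i t : In t (octahedral i) ->
  exists sg, (forall j, sg j = 1 \/ sg j = -1) /\
    forall p, In p t -> exists j, (j < i)%nat /\ p = fun a => sg j * basis j a.
Proof.
  revert t; induction i as [|i IH]; intros t; simpl.
  - intros [<-|[]]. exists (fun _ => 1). split; [now left|intros p []].
  - intros H.
    assert (H' : exists e u, (e = 1 \/ e = -1) /\ In u (octahedral i) /\
       t = (fun a => e * basis i a) :: u).
    { rewrite in_app_iff, !in_map_iff in H.
      destruct H as [(u & <- & Hu)|(u & <- & Hu)]; [exists 1|exists (-1)]; exists u;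
      (split; [lra|split; [easy|]]); f_equal; apply functional_extensionality; intros a;
      unfold antipode; ring. }
    destruct H' as (e & u & He & Hu & ->). destruct (IH u Hu) as (sg & Hs & Hp).
    exists (fun j => if (j =? i)%nat then e else sg j). split.
    + intros j. destruct (j =? i)%nat; auto.
    + intros p [<-|H1].
      * exists i. rewrite Nat.eqb_refl. auto.
      * destruct (Hp p H1) as (j & Hj & ->). exists j.
        destruct (Nat.eqb_spec j i); [lia|]. auto.
Qed.

Lemma sd_iter_in_facet M N i c t : (i <= M)%nat -> incl c (octahedral i) ->
  In t (sd_iter N i c) ->
  exists sg, (forall j, sg j = 1 \/ sg j = -1) /\ forall p, In p t -> in_facet M sg p.
Proof.
  intros Hi Hc. revert t; induction N as [|N IH]; intros t; simpl.
  - intros Ht. destruct (octahedral_facet i t (Hc t Ht)) as (sg & Hs & Hp).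
    exists sg. split; [easy|]. intros p Hpt. destruct (Hp p Hpt) as (j & Hj & ->).
    assert (Es : forall a, sg a * (sg j * basis j a) = if (a =? j)%nat then 1 else 0).
    { intros a. unfold basis. destruct (Nat.eqb_spec a j) as [->|]; [|ring].
      destruct (Hs j) as [-> | ->]; ring. }
    split.
    + intros a. rewrite Es. destruct (a =? j)%nat; lra.
    + rewrite (rsum_ext _ _ _ (fun a _ => Es a)).
      apply (rsum_delta M j (fun _ => 1)). lia.
  - intros H. apply in_flat_map in H as (u & Hu & Ht).
    destruct (IH u Hu) as (sg & Hs & Hp). exists sg. split; [easy|].
    intros p Hpt. apply (sd_closed (in_facet M sg)) with (n := i) (t := u) (t' := t); auto.
    + intros. now apply in_facet_barycenter.
    + apply (sd_iter_length N i c); auto. intros v Hv. now apply octahedral_length, Hc.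
Qed.

(* Fan's argument: the number of positive alternating simplices of the subdivided sphere
   does not depend on its dimension modulo 2. *)
Lemma fan_step M N m (lam : pt -> nat * bool) i : (S i <= M)%nat ->
  (forall p, (fst (lam p) < m)%nat) ->
  (forall p, on_sphere M p -> lam (antipode p) = flip (lam p)) ->
  (forall t p q, In t (sd_iter N (S i) (map (cons (basis i)) (octahedral i))) ->
     In p t -> In q t -> fst (lam p) = fst (lam q) -> snd (lam p) = snd (lam q)) ->
  parity (fun t => alternating m true (map lam t)) (sd_iter N (S i) (octahedral (S i))) =
  parity (fun t => alternating m true (map lam t)) (sd_iter N i (octahedral i)).
Proof.
  intros Hi Hm Hodd Hc.
  set (H := map (cons (basis i)) (octahedral i)) in *.
  assert (HH : incl H (octahedral (S i))) by (intros t Ht; simpl; apply in_app_iff; now left).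
  set (al := fun t => alternating m true (map lam t)).
  rewrite (chain_eq_sd_iter N _ _ _ (octahedral_hemispheres i) al). fold H.
  rewrite sd_iter_app, sd_iter_antipode, parity_app, parity_map, <- parity_xor.
  rewrite <- (chain_eq_sd_iter N _ _ _ (faces_hemisphere i) al). fold H.
  pose proof (chain_eq_faces_sd_iter N (S i) H (fun t Ht => octahedral_length _ _ (HH t Ht)) al) as E.
  replace (S i - 1)%nat with i in E by lia. rewrite <- E.
  rewrite parity_flat_map. apply parity_ext. intros t Ht.
  transitivity (parity (alternating m true) (faces (map lam t))).
  2: { now rewrite faces_map, parity_map. }
  rewrite alternating_faces.
  - unfold al. f_equal. rewrite <- alternating_flip, !map_map. f_equal.
    apply map_ext_in. intros p Hp. apply Hodd.
    destruct (sd_iter_in_facet M N (S i) H t) as (sg & Hs & Hf); auto.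
    apply (in_facet_on_sphere M sg); auto.
  - intros x Hx. apply in_map_iff in Hx as (p & <- & _). apply Hm.
  - intros x y Hx Hy. apply in_map_iff in Hx as (p & <- & Hp), Hy as (q & <- & Hq).
    now apply (Hc t).
Qed.

Lemma on_sphere_bound M p j : on_sphere M p -> (j < M)%nat -> -1 <= p j <= 1.
Proof.
  intros H Hj. pose proof (rsum_ge_term M (fun j => Rabs (p j)) j (fun j _ => Rabs_pos (p j)) Hj) as B.
  unfold on_sphere in H. rewrite H in B. revert B. unfold Rabs; destruct Rcase_abs; lra.
Qed.

(** Otherwise no small simplex carries opposite labels, and by [fan_step] the parity of the positive
    alternating simplices is 1 on every sphere, starting from the empty simplex. On the last sphere
    such a simplex would have [n + 2] distinct indices among [n + 1]. *)
Lemma tucker n N (lam : pt -> nat * bool) :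
  (forall p, (fst (lam p) < S n)%nat) ->
  (forall p, on_sphere (S (S n)) p -> lam (antipode p) = flip (lam p)) ->
  exists p q, on_sphere (S (S n)) p /\ on_sphere (S (S n)) q /\
    (forall j, (j < S (S n))%nat -> Rabs (p j - q j) <= 2 * (1 - / INR (S (S n))) ^ N) /\
    fst (lam p) = fst (lam q) /\ snd (lam p) = true /\ snd (lam q) = false.
Proof.
  intros Hm Hodd. apply NNPP. intros Hno.
  assert (G : forall i, (i <= S (S n))%nat ->
    parity (fun t => alternating (S n) true (map lam t)) (sd_iter N i (octahedral i)) = true).
  { induction i as [|i IH]; intros Hi.
    - assert (E : forall N, chain_eq (sd_iter N 0 (octahedral 0)) [[]]).
      { clear; intros N; induction N as [|N IH]; intros f; [easy|].
        exact (chain_eq_flat_map (sd 0) _ _ IH f). }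
      rewrite (E N). simpl. clear. induction n; auto.
    - rewrite fan_step with (M := S (S n)); auto; [apply IH; lia|].
      set (H := map (cons (basis i)) (octahedral i)).
      assert (HH : incl H (octahedral (S i))) by (intros t Ht; simpl; apply in_app_iff; now left).
      intros t p q Ht Hp Hq E.
      assert (HS : forall t p, In t (sd_iter N (S i) H) -> In p t -> on_sphere (S (S n)) p).
      { clear - HH Hi. intros t p Ht Hp.
        destruct (sd_iter_in_facet (S (S n)) N (S i) H t) as (sg & Hs & Hf); auto.
        apply (in_facet_on_sphere (S (S n)) sg); auto. }
      assert (HD : forall j p q, In p t -> In q t -> (j < S (S n))%nat ->
         Rabs (p j - q j) <= 2 * (1 - / INR (S (S n))) ^ N).
      { intros j a b Ha Hb Hj. apply (sd_iter_mesh (S (S n)) j N (S i) H) with (t := t); auto; try lia.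
        - intros u Hu. now apply octahedral_length, HH.
        - intros u x y Hu Hx Hy.
          assert (K : forall x, In x u -> -1 <= x j <= 1).
          { intros z Hz. apply on_sphere_bound with (M := S (S n)); auto.
            destruct (sd_iter_in_facet (S (S n)) 0 (S i) H u) as (sg & Hs & Hf); auto.
            apply (in_facet_on_sphere (S (S n)) sg); auto. }
          pose proof (K x Hx). pose proof (K y Hy). apply Rabs_le. lra. }
      destruct (snd (lam p)) eqn:Ep, (snd (lam q)) eqn:Eq; auto; exfalso; apply Hno.
      + exists p, q. repeat split; eauto.
      + exists q, p. repeat split; eauto. }
  specialize (G (S (S n)) (le_n _)).
  rewrite parity_false in G; [discriminate|].
  intros t Ht. destruct (alternating (S n) true (map lam t)) eqn:E; [|easy].
  apply alternating_length in E. rewrite length_map in E.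
  apply sd_iter_length in Ht; [lia|]. apply octahedral_length.
Qed.

(** * The Borsuk-Ulam theorem *)

Lemma cv_squeeze (u v : nat -> R) l :
  (forall N, Rabs (u N - l) <= v N) -> Un_cv v 0 -> Un_cv u l.
Proof.
  intros H Hv eps He. destruct (Hv eps He) as [N HN]. exists N. intros n Hn.
  specialize (HN n Hn). unfold Rdist in *. rewrite Rminus_0_r in HN.
  apply Rle_lt_trans with (v n); [apply H|].
  eapply Rle_lt_trans; [apply Rle_abs|exact HN].
Qed.

Lemma cv_subseq (u : nat -> R) l (phi : nat -> nat) :
  (forall N, (N <= phi N)%nat) -> Un_cv u l -> Un_cv (fun N => u (phi N)) l.
Proof.
  intros Hp Hu eps He. destruct (Hu eps He) as [N HN]. exists N. intros n Hn.
  apply HN. specialize (Hp n). lia.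
Qed.

Lemma cv_const a : Un_cv (fun _ => a) a.
Proof. intros eps He. exists 0%nat. intros. unfold Rdist. now rewrite Rminus_diag, Rabs_R0. Qed.

Lemma cv_ext (u v : nat -> R) l : (forall N, u N = v N) -> Un_cv u l -> Un_cv v l.
Proof. intros H Hu eps He. destruct (Hu eps He) as [N HN]. exists N. intros. rewrite <- H. auto. Qed.

Lemma cv_rsum M (f : nat -> nat -> R) g :
  (forall j, (j < M)%nat -> Un_cv (fun N => f N j) (g j)) ->
  Un_cv (fun N => rsum M (f N)) (rsum M g).
Proof.
  induction M as [|M IH]; simpl; intros H; [apply cv_const|].
  apply (CV_plus (fun N => rsum M (f N)) (fun N => f N M)); auto.
Qed.

Lemma cv_Rmax (u v : nat -> R) a b :
  Un_cv u a -> Un_cv v b -> Un_cv (fun N => Rmax (u N) (v N)) (Rmax a b).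
Proof.
  intros Hu Hv eps He. destruct (Hu eps He) as [N HN], (Hv eps He) as [N' HN'].
  exists (max N N'). intros n Hn.
  assert (H1 : Rdist (u n) a < eps) by (apply HN; lia).
  assert (H2 : Rdist (v n) b < eps) by (apply HN'; lia).
  unfold Rdist in *. apply Rabs_def2 in H1, H2. apply Rabs_def1;
  unfold Rmax; destruct (Rle_dec (u n) (v n)), (Rle_dec a b); lra.
Qed.

Lemma bolzano_weierstrass_coord (v : nat -> R) : (forall N, -1 <= v N <= 1) ->
  exists (phi : nat -> nat) l, (forall N, (N <= phi N)%nat) /\ Un_cv (fun N => v (phi N)) l.
Proof.
  intros Hv.
  destruct (Bolzano_Weierstrass v (fun x => -1 <= x <= 1) (compact_P3 (-1) 1) Hv) as [l Hl].
  assert (H : forall N : nat, exists p, (N <= p)%nat /\ Rabs (v p - l) <= / INR (S N)).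
  { intros N. assert (Hpos : 0 < / INR (S N)) by (apply Rinv_0_lt_compat, lt_0_INR; lia).
    destruct (Hl (disc l (mkposreal _ Hpos)) N) as (p & Hp & Hd).
    - now exists (mkposreal _ Hpos).
    - exists p. split; [easy|]. unfold disc in Hd; simpl in Hd. now apply Rlt_le. }
  apply functional_choice in H as [phi Hphi]. exists phi, l. split; [intros; apply Hphi|].
  apply (cv_squeeze _ (fun N => / INR (S N))); [intros; apply Hphi|].
  intros eps He. destruct (archimed_cor1 eps He) as (N & HN & HN0).
  exists N. intros n Hn. unfold Rdist. rewrite Rminus_0_r, Rabs_right.
  - apply Rle_lt_trans with (/ INR N); [|easy].
    apply Rinv_le_contravar; [apply lt_0_INR; lia|apply le_INR; lia].
  - apply Rle_ge, Rlt_le, Rinv_0_lt_compat, lt_0_INR; lia.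
Qed.

Lemma bolzano_weierstrass M (u : nat -> pt) :
  (forall N j, (j < M)%nat -> -1 <= u N j <= 1) ->
  exists (phi : nat -> nat) (p : pt), (forall N, (N <= phi N)%nat) /\
    forall j, (j < M)%nat -> Un_cv (fun N => u (phi N) j) (p j).
Proof.
  induction M as [|M IH]; intros H.
  - exists (fun N => N), (fun _ => 0). split; [easy|lia].
  - destruct IH as (phi & p & Hphi & Hp); [intros; apply H; lia|].
    destruct (bolzano_weierstrass_coord (fun N => u (phi N) M)) as (psi & l & Hpsi & Hl).
    { intros; apply H; lia. }
    exists (fun N => phi (psi N)), (fun j => if (j =? M)%nat then l else p j). split.
    + intros N. specialize (Hphi (psi N)). specialize (Hpsi N). lia.
    + intros j Hj. destruct (Nat.eqb_spec j M) as [->|]; [easy|].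
      apply (cv_subseq (fun N => u (phi N) j)); auto. apply Hp; lia.
Qed.

Fixpoint argmax (f : nat -> R) (n : nat) : nat :=
  match n with
  | O => O
  | S n' => if Rle_dec (f (argmax f n')) (f n) then n else argmax f n'
  end.

Lemma argmax_le f n : (argmax f n <= n)%nat.
Proof. induction n; simpl; [lia|]. destruct Rle_dec; lia. Qed.

Lemma argmax_ge f n i : (i <= n)%nat -> f i <= f (argmax f n).
Proof.
  induction n as [|n IH]; simpl; intros Hi.
  - replace i with 0%nat by lia. lra.
  - destruct (Nat.eq_dec i (S n)) as [->|].
    + destruct Rle_dec; lra.
    + specialize (IH ltac:(lia)). destruct Rle_dec; lra.
Qed.

Lemma argmax_ext f g n : (forall i, f i = g i) -> argmax f n = argmax g n.
Proof. intros H. f_equal. now apply functional_extensionality. Qed.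

(** If [F] has no zero, a point is labelled by its coordinate of largest modulus and the sign of
    that coordinate. The pairs from [tucker] make this coordinate change sign over shorter and
    shorter distances, so that all of [F] tends to zero along a subsequence. *)
Theorem borsuk_ulam n (F : pt -> nat -> R) :
  (forall p j, F (antipode p) j = - F p j) ->
  (forall u p, (forall N, on_sphere (S (S n)) (u N)) -> on_sphere (S (S n)) p ->
     (forall j, (j < S (S n))%nat -> Un_cv (fun N => u N j) (p j)) ->
     forall j, (j < S n)%nat -> Un_cv (fun N => F (u N) j) (F p j)) ->
  exists p, on_sphere (S (S n)) p /\ forall j, (j < S n)%nat -> F p j = 0.
Proof.
  intros Hodd Hcont. apply NNPP. intros Hno.
  set (am := fun p => argmax (fun j => Rabs (F p j)) n).
  assert (Ham : forall p, on_sphere (S (S n)) p -> F p (am p) <> 0).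
  { intros p Hp E. apply Hno. exists p. split; [easy|]. intros j Hj.
    pose proof (argmax_ge (fun j => Rabs (F p j)) n j ltac:(lia)) as B. fold (am p) in B.
    simpl in B. rewrite E, Rabs_R0 in B.
    apply NNPP. intros Hne. apply Rabs_pos_lt in Hne. lra. }
  (* The index depends on the moduli alone and is the same at antipodes; the sign is odd because the
     chosen value is nonzero on the sphere. *)
  set (lam := fun p => (am p, if Rlt_dec 0 (F p (am p)) then true else false)).
  assert (T : forall N : nat, exists pq : pt * pt,
    on_sphere (S (S n)) (fst pq) /\ on_sphere (S (S n)) (snd pq) /\
    (forall j, (j < S (S n))%nat ->
       Rabs (snd pq j - fst pq j) <= 2 * (1 - / INR (S (S n))) ^ N) /\
    forall i, (i < S n)%nat ->
      Rabs (F (fst pq) i) <= rsum (S n) (fun j => Rabs (F (fst pq) j - F (snd pq) j))).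
  { intros N. destruct (tucker n N lam) as (p & q & Hp & Hq & Hd & E & Ep & Eq).
    - intros p. simpl. pose proof (argmax_le (fun j => Rabs (F p j)) n). unfold am. lia.
    - intros p Hp. unfold lam, flip; simpl.
      assert (E : am (antipode p) = am p).
      { apply argmax_ext. intros i. rewrite Hodd. apply Rabs_Ropp. }
      rewrite E, Hodd. f_equal. specialize (Ham p Hp).
      destruct (Rlt_dec 0 (- F p (am p))), (Rlt_dec 0 (F p (am p))); simpl; auto; exfalso; lra.
    - exists (p, q). cbn [fst snd lam] in *. repeat split; auto.
      { intros j Hj. rewrite Rabs_minus_sym. auto. }
      intros i Hi.
      destruct (Rlt_dec 0 (F p (am p))) as [Hp0|]; [|discriminate].
      destruct (Rlt_dec 0 (F q (am q))) as [|Hq0]; [discriminate|].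
      pose proof (argmax_ge (fun j => Rabs (F p j)) n i ltac:(lia)) as B. fold (am p) in B.
      cbn beta in B. eapply Rle_trans; [exact B|].
      (* In the coordinate [am p] the value at [q] is not positive, so that the value at [p] is at
         most their difference. *)
      eapply Rle_trans;
        [|apply (rsum_ge_term (S n) (fun j => Rabs (F p j - F q j)) (am p))].
      + cbn beta. rewrite <- E in Hq0. rewrite !Rabs_right by lra. lra.
      + intros; apply Rabs_pos.
      + pose proof (argmax_le (fun j => Rabs (F p j)) n). unfold am. lia. }
  apply functional_choice in T as [pq Hpq].
  destruct (bolzano_weierstrass (S (S n)) (fun N => fst (pq N))) as (phi & p & Hphi & Hp).
  { intros N j Hj. apply on_sphere_bound with (M := S (S n)); [apply Hpq|easy]. }
  assert (Hq : forall j, (j < S (S n))%nat -> Un_cv (fun N => snd (pq (phi N)) j) (p j)).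
  { intros j Hj.
    apply (cv_ext (fun N => (snd (pq (phi N)) j - fst (pq (phi N)) j) + fst (pq (phi N)) j)).
    { intros; ring. }
    rewrite <- (Rplus_0_l (p j)).
    apply (CV_plus (fun N => snd (pq (phi N)) j - fst (pq (phi N)) j)
                   (fun N => fst (pq (phi N)) j)); [|now apply Hp].
    apply (cv_subseq (fun N => snd (pq N) j - fst (pq N) j)); [easy|].
    apply (cv_squeeze _ (fun N => 2 * (1 - / INR (S (S n))) ^ N)).
    - intros N. rewrite Rminus_0_r. now apply Hpq.
    - rewrite <- (Rmult_0_r 2).
      apply (CV_mult (fun _ => 2) (fun N => (1 - / INR (S (S n))) ^ N)); [apply cv_const|].
      intros eps He. destruct (pow_lt_1_zero (1 - / INR (S (S n)))) with (y := eps) as [N HN]; auto.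
      + assert (1 <= INR (S (S n))) by (apply (le_INR 1); lia).
        assert (0 < / INR (S (S n)) <= 1).
        { split; [apply Rinv_0_lt_compat; lra|]. rewrite <- Rinv_1.
          apply Rinv_le_contravar; lra. }
        rewrite Rabs_right; lra.
      + exists N. intros m Hm. unfold Rdist. rewrite Rminus_0_r. auto. }
  assert (Hps : on_sphere (S (S n)) p).
  { apply (UL_sequence (fun N => rsum (S (S n)) (fun j => Rabs (fst (pq (phi N)) j)))).
    - apply cv_rsum. intros j Hj. apply (cv_cvabs (fun N => fst (pq (phi N)) j)). now apply Hp.
    - apply (cv_ext (fun _ => 1)); [|apply cv_const]. intros N. symmetry. apply Hpq. }
  apply Hno. exists p. split; [easy|]. intros i Hi.
  assert (C1 := Hcont (fun N => fst (pq (phi N))) p (fun N => proj1 (Hpq (phi N))) Hps Hp).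
  assert (C2 := Hcont (fun N => snd (pq (phi N))) p (fun N => proj1 (proj2 (Hpq (phi N)))) Hps Hq).
  apply (UL_sequence (fun N => F (fst (pq (phi N))) i)); [now apply C1|].
  apply (cv_squeeze _ (fun N => rsum (S n)
    (fun j => Rabs (F (fst (pq (phi N))) j - F (snd (pq (phi N))) j)))).
  - intros N. rewrite Rminus_0_r. now apply Hpq.
  - rewrite <- (rsum_zero (S n) (fun _ => 0)) by easy. apply cv_rsum. intros j Hj.
    rewrite <- Rabs_R0, <- (Rminus_diag (F p j)).
    apply (cv_cvabs (fun N => F (fst (pq (phi N))) j - F (snd (pq (phi N))) j)).
    apply CV_minus; auto.
Qed.

(** * The van Kampen-Flores obstruction *)

(** Barycentric coordinates of the points of the join of [k] copies of a
    three-point set (the vertices [3 * i + c] with [c < 3]) and of a simplex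
    on the [s] vertices [3 * k + j]. *)
Definition join_point (k s : nat) (x : nat -> R) : Prop :=
  (forall u, (u < 3 * k + s)%nat -> 0 <= x u) /\
  rsum (3 * k + s) x = 1 /\
  (forall i c c', (i < k)%nat -> (c < 3)%nat -> (c' < 3)%nat -> c <> c' ->
     x (3 * i + c)%nat = 0 \/ x (3 * i + c')%nat = 0).

(** Coordinates on the plane of triples with sum zero. A block takes up a plane because the deleted
    join of three points is a hexagon. *)
Definition block_form (p : pt) (i c : nat) : R :=
  match c with
  | O => p (2 * i)%nat
  | S O => p (2 * i + 1)%nat
  | _ => - (p (2 * i)%nat + p (2 * i + 1)%nat)
  end.

Definition block_max (p : pt) (i : nat) : R :=
  Rmax (block_form p i 0) (Rmax (block_form p i 1) (block_form p i 2)).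

(** The deleted join of the complex of [join_point] is the set of the signed
    weights which have, in each block of three, at most one positive and at most
    one negative coordinate; [signed_weight] maps R^(2k+s) to the cone over it.
    In a block, three numbers with sum zero are shifted by their median,
    which is the opposite of the sum of their maximum and minimum. *)
Definition signed_weight (k : nat) (p : pt) (u : nat) : R :=
  if (u <? 3 * k)%nat
  then block_form p (u / 3) (u mod 3) + block_max p (u / 3) - block_max (antipode p) (u / 3)
  else p (2 * k + (u - 3 * k))%nat.

Lemma block_form_antipode p i c : block_form (antipode p) i c = - block_form p i c.
Proof. destruct c as [|[|c]]; simpl; unfold antipode; ring. Qed.

Lemma signed_weight_antipode k p u :
  signed_weight k (antipode p) u = - signed_weight k p u.
Proof.
  unfold signed_weight. rewrite antipode_involutive, block_form_antipode.
  destruct (u <? 3 * k)%nat; [ring|reflexivity].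
Qed.

Lemma signed_weight_block k p i c : (i < k)%nat -> (c < 3)%nat ->
  signed_weight k p (3 * i + c) =
  block_form p i c + block_max p i - block_max (antipode p) i.
Proof.
  intros Hi Hc. unfold signed_weight.
  replace ((3 * i + c) / 3)%nat with i by (apply (Nat.div_unique _ 3 _ c); lia).
  replace ((3 * i + c) mod 3)%nat with c by (apply (Nat.mod_unique _ 3 i); lia).
  destruct (Nat.ltb_spec (3 * i + c) (3 * k)); [easy|lia].
Qed.

(** After the shift by the median only the largest of the three can exceed zero. *)
Lemma signed_weight_pos_unique k p i c c' : (i < k)%nat -> (c < 3)%nat -> (c' < 3)%nat ->
  c <> c' -> signed_weight k p (3 * i + c) <= 0 \/ signed_weight k p (3 * i + c') <= 0.
Proof.
  intros Hi Hc Hc' Hne. rewrite !signed_weight_block by easy.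
  unfold block_max. rewrite !block_form_antipode.
  assert (Hcc : forall f : nat -> R, f 0%nat + f 1%nat + f 2%nat = 0 ->
    f c + Rmax (f 0%nat) (Rmax (f 1%nat) (f 2%nat)) -
      Rmax (- f 0%nat) (Rmax (- f 1%nat) (- f 2%nat)) <= 0 \/
    f c' + Rmax (f 0%nat) (Rmax (f 1%nat) (f 2%nat)) -
      Rmax (- f 0%nat) (Rmax (- f 1%nat) (- f 2%nat)) <= 0).
  { intros f E. unfold Rmax.
    destruct c as [|[|[|c]]]; try lia; destruct c' as [|[|[|c']]]; try lia;
    repeat destruct Rle_dec; lra. }
  apply (Hcc (block_form p i)). simpl; ring.
Qed.

(** If the weights of a block vanish, its three forms are equal, and their sum is zero. *)
Lemma signed_weight_eq0 k s p : (forall u, (u < 3 * k + s)%nat -> signed_weight k p u = 0) ->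
  forall j, (j < 2 * k + s)%nat -> p j = 0.
Proof.
  intros H j Hj. destruct (lt_dec j (2 * k)) as [Hjk|Hjk].
  - set (i := (j / 2)%nat).
    assert (Hj2 : (j = 2 * i + j mod 2)%nat) by (apply Nat.div_mod; lia).
    pose proof (Nat.mod_upper_bound j 2 ltac:(lia)) as Hm.
    assert (Hi : (i < k)%nat) by lia.
    pose proof (H (3 * i + 0)%nat ltac:(lia)) as H0.
    pose proof (H (3 * i + 1)%nat ltac:(lia)) as H1.
    pose proof (H (3 * i + 2)%nat ltac:(lia)) as H2.
    rewrite signed_weight_block in H0, H1, H2 by lia. simpl block_form in H0, H1, H2.
    rewrite Hj2. destruct (j mod 2)%nat as [|[|?]]; [|  |lia].
    + rewrite Nat.add_0_r. simpl in *. lra.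
    + simpl in *. lra.
  - specialize (H (3 * k + (j - 2 * k))%nat ltac:(lia)). unfold signed_weight in H.
    destruct (Nat.ltb_spec (3 * k + (j - 2 * k)) (3 * k)); [lia|].
    rewrite <- H. f_equal. lia.
Qed.

Lemma cv_opp (u : nat -> R) l : Un_cv u l -> Un_cv (fun N => - u N) (- l).
Proof. exact (CV_opp u l). Qed.

Lemma cv_block_form (v : nat -> pt) p i c :
  Un_cv (fun N => v N (2 * i)%nat) (p (2 * i)%nat) ->
  Un_cv (fun N => v N (2 * i + 1)%nat) (p (2 * i + 1)%nat) ->
  Un_cv (fun N => block_form (v N) i c) (block_form p i c).
Proof.
  intros H0 H1. destruct c as [|[|c]]; simpl; try easy.
  apply cv_opp. exact (CV_plus _ _ _ _ H0 H1).
Qed.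

Lemma cv_block_max (v : nat -> pt) p i :
  Un_cv (fun N => v N (2 * i)%nat) (p (2 * i)%nat) ->
  Un_cv (fun N => v N (2 * i + 1)%nat) (p (2 * i + 1)%nat) ->
  Un_cv (fun N => block_max (v N) i) (block_max p i).
Proof.
  intros H0 H1. unfold block_max. repeat apply cv_Rmax; now apply cv_block_form.
Qed.

Lemma cv_signed_weight k s (v : nat -> pt) p :
  (forall j, (j < 2 * k + s)%nat -> Un_cv (fun N => v N j) (p j)) ->
  forall u, (u < 3 * k + s)%nat ->
  Un_cv (fun N => signed_weight k (v N) u) (signed_weight k p u).
Proof.
  intros H u Hu. unfold signed_weight. destruct (Nat.ltb_spec u (3 * k)) as [Hk|Hk].
  - assert (Hi : (u / 3 < k)%nat) by (apply Nat.Div0.div_lt_upper_bound; lia).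
    apply (CV_minus (fun N => block_form (v N) (u / 3) (u mod 3) + block_max (v N) (u / 3))
                    (fun N => block_max (antipode (v N)) (u / 3))).
    + apply (CV_plus (fun N => block_form (v N) (u / 3) (u mod 3))
                     (fun N => block_max (v N) (u / 3))).
      * apply cv_block_form; apply H; lia.
      * apply cv_block_max; apply H; lia.
    + apply (cv_block_max (fun N => antipode (v N))); unfold antipode; apply cv_opp, H; lia.
  - apply H. lia.
Qed.

(** The negative part is the positive part at the antipode; one definition serves both, and oddness
    becomes an exchange of the two. *)
Definition pos_weight (k : nat) (p : pt) (u : nat) : R := Rmax (signed_weight k p u) 0.

Definition pos_mass (k s : nat) (p : pt) : R := rsum (3 * k + s) (pos_weight k p).

Definition pos_point (k s : nat) (p : pt) (u : nat) : R := pos_weight k p u / pos_mass k s p.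

Lemma pos_mass_ge0 k s p : 0 <= pos_mass k s p.
Proof. apply rsum_nonneg. intros. apply Rmax_r. Qed.

Lemma join_point_pos k s p : 0 < pos_mass k s p -> join_point k s (pos_point k s p).
Proof.
  intros Hp. unfold pos_point. split; [|split].
  - intros u _. apply Rmult_le_pos; [apply Rmax_r|]. now apply Rlt_le, Rinv_0_lt_compat.
  - rewrite (rsum_ext _ _ (fun u => / pos_mass k s p * pos_weight k p u)).
    + rewrite rsum_scal. fold (pos_mass k s p). field. lra.
    + intros. field. lra.
  - intros i c c' Hi Hc Hc' Hne.
    destruct (signed_weight_pos_unique k p i c c' Hi Hc Hc' Hne) as [H|H];
    [left|right]; unfold pos_weight; rewrite Rmax_right by easy; field; lra.
Qed.

Lemma cv_pos_mass k s (v : nat -> pt) p :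
  (forall j, (j < 2 * k + s)%nat -> Un_cv (fun N => v N j) (p j)) ->
  Un_cv (fun N => pos_mass k s (v N)) (pos_mass k s p).
Proof.
  intros H. unfold pos_mass. apply cv_rsum. intros u Hu. unfold pos_weight.
  apply cv_Rmax; [now apply (cv_signed_weight k s)|apply cv_const].
Qed.

Lemma cv_pos_point k s (v : nat -> pt) p : 0 < pos_mass k s p ->
  (forall j, (j < 2 * k + s)%nat -> Un_cv (fun N => v N j) (p j)) ->
  forall u, (u < 3 * k + s)%nat ->
  Un_cv (fun N => pos_point k s (v N) u) (pos_point k s p u).
Proof.
  intros Hp H u Hu. unfold pos_point, Rdiv.
  apply (CV_mult (fun N => pos_weight k (v N) u) (fun N => / pos_mass k s (v N))).
  - apply cv_Rmax; [now apply (cv_signed_weight k s)|apply cv_const].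
  - apply (continuity_seq Rinv (fun N => pos_mass k s (v N))); [|now apply cv_pos_mass].
    apply (continuity_pt_inv id); [apply derivable_continuous_pt, derivable_pt_id|].
    unfold id. lra.
Qed.

Lemma eventually_forall M (P : nat -> nat -> Prop) :
  (forall u, (u < M)%nat -> exists N0, forall N, (N0 <= N)%nat -> P u N) ->
  exists N0, forall N, (N0 <= N)%nat -> forall u, (u < M)%nat -> P u N.
Proof.
  induction M as [|M IH]; intros H.
  - exists 0%nat. intros. lia.
  - destruct IH as [N0 HN0]; [intros; apply H; lia|].
    destruct (H M ltac:(lia)) as [N1 HN1].
    exists (max N0 N1). intros N HN u Hu.
    destruct (Nat.eq_dec u M) as [->|]; [apply HN1|apply HN0]; lia.
Qed.

Definition join_continuous (k s D : nat) (Phi : (nat -> R) -> nat -> R) : Prop :=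
  forall x, join_point k s x -> forall eps, 0 < eps -> exists del, 0 < del /\
    forall y, join_point k s y ->
      (forall u, (u < 3 * k + s)%nat -> Rabs (y u - x u) < del) ->
      forall j, (j < D)%nat -> Rabs (Phi y j - Phi x j) < eps.

Definition join_injective (k s D : nat) (Phi : (nat -> R) -> nat -> R) : Prop :=
  forall x y, join_point k s x -> join_point k s y ->
    (forall j, (j < D)%nat -> Phi x j = Phi y j) ->
    forall u, (u < 3 * k + s)%nat -> x u = y u.

Lemma cv_join_continuous k s D Phi (v : nat -> pt) p :
  join_continuous k s D Phi -> 0 < pos_mass k s p ->
  (forall j, (j < 2 * k + s)%nat -> Un_cv (fun N => v N j) (p j)) ->
  forall j, (j < D)%nat ->
  Un_cv (fun N => Phi (pos_point k s (v N)) j) (Phi (pos_point k s p) j).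
Proof.
  intros Hc Hp H j Hj eps He.
  destruct (Hc _ (join_point_pos k s p Hp) eps He) as (del & Hdel & Hd).
  destruct (cv_pos_mass k s v p H _ Hp) as [N0 HN0].
  destruct (eventually_forall (3 * k + s)
    (fun u N => Rabs (pos_point k s (v N) u - pos_point k s p u) < del)) as [N1 HN1].
  { intros u Hu. destruct (cv_pos_point k s v p Hp H u Hu del Hdel) as [N HN].
    exists N. intros N' HN'. apply HN. lia. }
  exists (max N0 N1). intros N HN. unfold Rdist. apply Hd; auto.
  - apply join_point_pos. specialize (HN0 N ltac:(lia)). unfold Rdist in HN0.
    apply Rabs_def2 in HN0. lra.
  - apply HN1. lia.
Qed.

Lemma atan_inj x y : atan x = atan y -> x = y.
Proof.
  intros E. destruct (Rtotal_order x y) as [H|[H|H]]; [|easy|];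
  apply atan_increasing in H; lra.
Qed.

Lemma rsum_eq0 M f : (forall i, (i < M)%nat -> 0 <= f i) -> rsum M f = 0 ->
  forall i, (i < M)%nat -> f i = 0.
Proof.
  intros H0 H i Hi. pose proof (rsum_ge_term M f i H0 Hi). specialize (H0 i Hi). lra.
Qed.

Lemma pos_weight_eq0 k p u :
  pos_weight k p u = pos_weight k (antipode p) u -> signed_weight k p u = 0.
Proof.
  unfold pos_weight. rewrite signed_weight_antipode.
  unfold Rmax. repeat destruct Rle_dec; lra.
Qed.

(* [atan] makes the map bounded, so that the factor [Rmin] extends it continuously
   to the points of the sphere where one of the two masses vanishes. *)
Definition join_test (k s : nat) (Phi : (nat -> R) -> nat -> R) (p : pt) (j : nat) : R :=
  match j with
  | O => pos_mass k s p - pos_mass k s (antipode p)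
  | S j' => Rmin (pos_mass k s p) (pos_mass k s (antipode p)) *
      (atan (Phi (pos_point k s p) j') - atan (Phi (pos_point k s (antipode p)) j'))
  end.

Lemma join_test_odd k s Phi p j : join_test k s Phi (antipode p) j = - join_test k s Phi p j.
Proof.
  destruct j as [|j]; simpl; rewrite antipode_involutive; [ring|].
  rewrite Rmin_comm. ring.
Qed.

Lemma join_test_continuous k s D Phi (v : nat -> pt) p :
  join_continuous k s D Phi ->
  (forall j, (j < 2 * k + s)%nat -> Un_cv (fun N => v N j) (p j)) ->
  forall j, (j < S D)%nat -> Un_cv (fun N => join_test k s Phi (v N) j) (join_test k s Phi p j).
Proof.
  intros Hc H j Hj.
  assert (H' : forall j, (j < 2 * k + s)%nat -> Un_cv (fun N => antipode (v N) j) (antipode p j)).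
  { intros i Hi. apply cv_opp. now apply H. }
  pose proof (cv_pos_mass k s v p H) as M1.
  pose proof (cv_pos_mass k s (fun N => antipode (v N)) (antipode p) H') as M2.
  destruct j as [|j]; simpl; [now apply CV_minus|].
  assert (M3 : Un_cv (fun N => Rmin (pos_mass k s (v N)) (pos_mass k s (antipode (v N))))
                     (Rmin (pos_mass k s p) (pos_mass k s (antipode p)))).
  { assert (E : forall a b, Rmin a b = - Rmax (- a) (- b)).
    { intros a b. unfold Rmin, Rmax. destruct (Rle_dec a b), (Rle_dec (-a) (-b)); lra. }
    rewrite E. eapply cv_ext; [intros N; symmetry; apply E|].
    apply cv_opp, cv_Rmax; now apply cv_opp. }
  pose proof (pos_mass_ge0 k s p) as P1. pose proof (pos_mass_ge0 k s (antipode p)) as P2.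
  (* Where a mass vanishes, [pos_point] need not have a limit, but the difference of the two [atan]
     is at most [PI] in modulus while the factor [Rmin] tends to zero. *)
  destruct (Req_dec (Rmin (pos_mass k s p) (pos_mass k s (antipode p))) 0) as [E|E].
  - rewrite E, Rmult_0_l. rewrite E in M3.
    apply (cv_squeeze _ (fun N => Rmin (pos_mass k s (v N)) (pos_mass k s (antipode (v N))) * PI)).
    + intros N. rewrite Rminus_0_r, Rabs_mult.
      pose proof (atan_bound (Phi (pos_point k s (v N)) j)).
      pose proof (atan_bound (Phi (pos_point k s (antipode (v N))) j)).
      rewrite (Rabs_right (Rmin _ _)).
      * apply Rmult_le_compat_l; [|apply Rabs_le; lra].
        apply Rmin_glb; apply pos_mass_ge0.
      * apply Rle_ge, Rmin_glb; apply pos_mass_ge0.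
    + rewrite <- (Rmult_0_l PI). apply (CV_mult _ (fun _ => PI)); [easy|apply cv_const].
  - assert (Q1 : 0 < pos_mass k s p /\ 0 < pos_mass k s (antipode p)).
    { revert E. unfold Rmin. destruct Rle_dec; lra. }
    destruct Q1 as [Q1 Q2].
    assert (CA : forall v p, 0 < pos_mass k s p ->
      (forall j, (j < 2 * k + s)%nat -> Un_cv (fun N => v N j) (p j)) ->
      Un_cv (fun N => atan (Phi (pos_point k s (v N)) j)) (atan (Phi (pos_point k s p) j))).
    { intros w q Hq Hw. apply (continuity_seq atan (fun N => Phi (pos_point k s (w N)) j)).
      - apply derivable_continuous_pt, derivable_pt_atan.
      - apply (cv_join_continuous k s D); auto. lia. }
    apply (CV_mult (fun N => Rmin (pos_mass k s (v N)) (pos_mass k s (antipode (v N))))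
      (fun N => atan (Phi (pos_point k s (v N)) j) -
                atan (Phi (pos_point k s (antipode (v N))) j))); [easy|].
    apply (CV_minus (fun N => atan (Phi (pos_point k s (v N)) j))
                    (fun N => atan (Phi (pos_point k s (antipode (v N))) j))); [now apply CA|].
    now apply (CA (fun N => antipode (v N)) (antipode p)).
Qed.

(** At a common zero of the functions [join_test] the two masses agree. Either both are zero, or
    injectivity makes the positive part equal to the negative one; in both cases all weights vanish,
    and with them [p], which lies on the sphere. *)
Theorem join_not_embeddable k s D Phi : (2 * k + s = S (S D))%nat ->
  join_continuous k s D Phi -> ~ join_injective k s D Phi.
Proof.
  intros HD Hc Hinj.
  destruct (borsuk_ulam D (join_test k s Phi)) as (p & Hp & Hz).
  - apply join_test_odd.
  - intros v p _ _ H. rewrite <- HD in H. now apply join_test_continuous.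
  - assert (Hsw : forall u, (u < 3 * k + s)%nat -> signed_weight k p u = 0).
    { pose proof (Hz 0%nat ltac:(lia)) as H0. simpl in H0.
      pose proof (pos_mass_ge0 k s p) as P1.
      intros u Hu. apply pos_weight_eq0.
      destruct (Req_dec (pos_mass k s p) 0) as [E|E].
      - assert (Hw : forall q, pos_mass k s q = 0 -> pos_weight k q u = 0).
        { intros q Hq. apply (rsum_eq0 (3 * k + s) (pos_weight k q)); auto.
          intros; apply Rmax_r. }
        rewrite !Hw; auto; lra.
      - assert (Hx : pos_point k s p u = pos_point k s (antipode p) u).
        { apply Hinj; auto; try (apply join_point_pos; lra).
          intros j Hj. specialize (Hz (S j) ltac:(lia)). simpl in Hz.
          apply Rmult_integral in Hz as [Hz|Hz].
          - revert Hz. unfold Rmin. destruct Rle_dec; lra.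
          - apply atan_inj. lra. }
        unfold pos_point in Hx. replace (pos_mass k s (antipode p)) with (pos_mass k s p) in Hx by lra.
        apply (Rmult_eq_reg_r (/ pos_mass k s p)); [exact Hx|].
        apply Rinv_neq_0_compat. lra. }
    unfold on_sphere in Hp. rewrite rsum_zero in Hp; [lra|].
    intros j Hj. rewrite (signed_weight_eq0 k s p Hsw) by lia. apply Rabs_R0.
Qed.

(** * Complete multipartite subhypergraphs of an embedded hypergraph *)

(** Weights are gathered at the vertices of the hypergraph, so that combinations indexed by the join
    and combinations indexed by positions in an edge become comparable. *)
Definition vertex_weight (M : nat) (g : nat -> nat) (x : nat -> R) (v : nat) : R :=
  rsum M (fun u => if (g u =? v)%nat then x u else 0).

Definition combination (M : nat) (g : nat -> nat) (phi : nat -> pt) (x : nat -> R) : pt :=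
  fun j => rsum M (fun u => x u * phi (g u) j).

Lemma rsum_vertex_weight M g x e f : NoDup e ->
  (forall u, (u < M)%nat -> x u <> 0 -> In (g u) e) ->
  rsum M (fun u => x u * f (g u)) =
  rsum (length e) (fun i => vertex_weight M g x (nth i e 0%nat) * f (nth i e 0%nat)).
Proof.
  intros He. induction M as [|M IH]; intros Hs; simpl.
  - rewrite rsum_zero; [easy|]. intros. unfold vertex_weight; simpl. ring.
  - rewrite IH by (intros; apply Hs; auto).
    unfold vertex_weight at 2; simpl. fold (vertex_weight M g x).
    rewrite (rsum_ext (length e) (fun i => (_ + _) * _) (fun i =>
      vertex_weight M g x (nth i e 0%nat) * f (nth i e 0%nat) +
      (if (g M =? nth i e 0%nat)%nat then x M else 0) * f (nth i e 0%nat)))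
      by (intros; unfold vertex_weight; ring).
    rewrite rsum_plus. f_equal.
    destruct (Req_dec (x M) 0) as [E|E].
    + rewrite E, Rmult_0_l, rsum_zero; [easy|]. intros. destruct (_ =? _)%nat; ring.
    + destruct (In_nth e (g M) 0%nat (Hs M (Nat.lt_succ_diag_r M) E)) as (i0 & Hi0 & Ei0).
      rewrite <- (rsum_delta (length e) i0 (fun i => x M * f (g M)) Hi0).
      apply rsum_ext. intros i Hi.
      destruct (Nat.eqb_spec i i0) as [->|Hne].
      * rewrite Ei0, Nat.eqb_refl. reflexivity.
      * destruct (Nat.eqb_spec (g M) (nth i e 0%nat)) as [E'|]; [|ring].
        exfalso. apply Hne. apply (proj1 (NoDup_nth e 0%nat) He); auto. congruence.
Qed.

Lemma vertex_weight_outside M g x v :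
  (forall u, (u < M)%nat -> x u <> 0 -> g u <> v) -> vertex_weight M g x v = 0.
Proof.
  intros H. apply rsum_zero. intros u Hu. destruct (Nat.eqb_spec (g u) v); [|easy].
  apply NNPP. intros Hx. now apply (H u).
Qed.

Lemma vertex_weight_inj M g x u :
  (forall a b, (a < M)%nat -> (b < M)%nat -> g a = g b -> a = b) -> (u < M)%nat ->
  vertex_weight M g x (g u) = x u.
Proof.
  intros Hg Hu. rewrite <- (rsum_delta M u x Hu). apply rsum_ext. intros a Ha.
  destruct (Nat.eqb_spec (g a) (g u)), (Nat.eqb_spec a u); subst; auto; [|easy].
  exfalso. auto.
Qed.

Lemma nth_map_phi (phi : nat -> pt) e i : (i < length e)%nat ->
  nth i (map phi e) (fun _ => 0) = phi (nth i e 0%nat).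
Proof.
  intros Hi. rewrite (nth_indep _ _ (phi 0%nat)) by (now rewrite length_map). apply map_nth.
Qed.

Lemma conv_combination m M g phi x e : NoDup e ->
  (forall u, (u < M)%nat -> 0 <= x u) -> rsum M x = 1 ->
  (forall u, (u < M)%nat -> x u <> 0 -> In (g u) e) ->
  conv m (map phi e) (combination M g phi x).
Proof.
  intros He H0 H1 Hs. exists (fun i => vertex_weight M g x (nth i e 0%nat)).
  rewrite length_map. split; [|split].
  - intros i Hi. apply rsum_nonneg. intros u Hu. destruct (_ =? _)%nat; [auto|lra].
  - pose proof (rsum_vertex_weight M g x e (fun _ => 1) He Hs) as E.
    rewrite (rsum_ext M _ x) in E by (intros; ring). rewrite H1 in E. rewrite E.
    apply rsum_ext. intros; ring.
  - intros j Hj. unfold combination.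
    rewrite (rsum_vertex_weight M g x e (fun v => phi v j) He Hs).
    apply rsum_ext. intros i Hi. now rewrite nth_map_phi.
Qed.

(** Uniqueness of barycentric coordinates, in a form that allows two different index sets. *)
Lemma aff_indep_vertex_weight m phi e M g x M' g' x' : NoDup e -> aff_indep m (map phi e) ->
  (forall u, (u < M)%nat -> x u <> 0 -> In (g u) e) ->
  (forall u, (u < M')%nat -> x' u <> 0 -> In (g' u) e) ->
  rsum M x = rsum M' x' ->
  veq m (combination M g phi x) (combination M' g' phi x') ->
  forall v, vertex_weight M g x v = vertex_weight M' g' x' v.
Proof.
  intros He Ha Hs Hs' H1 Hv v.
  destruct (in_dec Nat.eq_dec v e) as [Hin|Hout].
  - destruct (In_nth e v 0%nat Hin) as (i & Hi & <-).
    apply Rminus_diag_uniq.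
    apply (Ha (fun i => vertex_weight M g x (nth i e 0%nat) -
                        vertex_weight M' g' x' (nth i e 0%nat))); rewrite ?length_map; auto.
    + pose proof (rsum_vertex_weight M g x e (fun _ => 1) He Hs) as E.
      pose proof (rsum_vertex_weight M' g' x' e (fun _ => 1) He Hs') as E'.
      rewrite (rsum_ext M _ x) in E by (intros; ring).
      rewrite (rsum_ext M' _ x') in E' by (intros; ring).
      rewrite (rsum_ext _ _ (fun i => vertex_weight M g x (nth i e 0%nat) * 1 +
        (-1) * (vertex_weight M' g' x' (nth i e 0%nat) * 1))) by (intros; ring).
      rewrite rsum_plus, rsum_scal, <- E, <- E'. lra.
    + intros j Hj. specialize (Hv j Hj). unfold combination in Hv.
      rewrite (rsum_vertex_weight M g x e (fun v => phi v j) He Hs) in Hv.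
      rewrite (rsum_vertex_weight M' g' x' e (fun v => phi v j) He Hs') in Hv.
      rewrite (rsum_ext _ _ (fun i =>
        vertex_weight M g x (nth i e 0%nat) * phi (nth i e 0%nat) j +
        (-1) * (vertex_weight M' g' x' (nth i e 0%nat) * phi (nth i e 0%nat) j)))
        by (intros a Ha'; rewrite nth_map_phi by easy; ring).
      rewrite rsum_plus, rsum_scal, Hv. lra.
  - rewrite !vertex_weight_outside; auto; intros u Hu Hx E; apply Hout; rewrite <- E; auto.
Qed.

Lemma rsum_Rabs M f : Rabs (rsum M f) <= rsum M (fun i => Rabs (f i)).
Proof.
  induction M as [|M IH]; simpl; [rewrite Rabs_R0; lra|].
  eapply Rle_trans; [apply Rabs_triang|]. lra.
Qed.

Lemma rsum_le M f g : (forall i, (i < M)%nat -> f i <= g i) -> rsum M f <= rsum M g.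
Proof. induction M; simpl; intros H; [lra|]. apply Rplus_le_compat; auto. Qed.

Lemma dist_le_sum m p q : Defs.dist m p q <= rsum m (fun j => Rabs (p j - q j)).
Proof.
  assert (H0 : 0 <= rsum m (fun j => Rabs (p j - q j))) by (apply rsum_nonneg; intros; apply Rabs_pos).
  unfold Defs.dist. rewrite <- (sqrt_pow2 (rsum m (fun j => Rabs (p j - q j)))) by easy.
  apply sqrt_le_1_alt. clear H0. induction m as [|m IH]; cbn [rsum]; [simpl; lra|].
  assert (H0 : 0 <= rsum m (fun j => Rabs (p j - q j))) by (apply rsum_nonneg; intros; apply Rabs_pos).
  rewrite <- (pow2_abs (p m - q m)). pose proof (Rabs_pos (p m - q m)). nra.
Qed.

Lemma coord_le_dist m p q j : (j < m)%nat -> Rabs (p j - q j) <= Defs.dist m p q.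
Proof.
  intros Hj. unfold Defs.dist. rewrite <- (sqrt_pow2 (Rabs (p j - q j))) by apply Rabs_pos.
  apply sqrt_le_1_alt. rewrite pow2_abs.
  apply (rsum_ge_term m (fun j => (p j - q j) ^ 2)); auto. intros. apply pow2_ge_0.
Qed.

Lemma combination_continuous m M g phi eps : 0 < eps -> exists del, 0 < del /\
  forall x y, (forall u, (u < M)%nat -> Rabs (y u - x u) < del) ->
  Defs.dist m (combination M g phi x) (combination M g phi y) < eps.
Proof.
  intros He. set (C := rsum m (fun j => rsum M (fun u => Rabs (phi (g u) j)))).
  assert (HC : 0 <= C) by (repeat (apply rsum_nonneg; intros); apply Rabs_pos).
  exists (eps / (C + 1)). assert (Hd : 0 < eps / (C + 1)) by (apply Rdiv_lt_0_compat; lra).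
  split; [easy|]. intros x y H.
  eapply Rle_lt_trans; [apply dist_le_sum|].
  apply Rle_lt_trans with (eps / (C + 1) * C).
  - unfold C. rewrite <- rsum_scal. apply rsum_le. intros j _.
    unfold combination. replace (rsum M (fun u => x u * phi (g u) j) - rsum M (fun u => y u * phi (g u) j))
      with (rsum M (fun u => (x u - y u) * phi (g u) j)).
    + eapply Rle_trans; [apply rsum_Rabs|]. rewrite <- rsum_scal. apply rsum_le. intros u Hu.
      rewrite Rabs_mult. apply Rmult_le_compat_r; [apply Rabs_pos|].
      rewrite Rabs_minus_sym. now apply Rlt_le, H.
    + rewrite (rsum_ext _ _ (fun u => x u * phi (g u) j + (-1) * (y u * phi (g u) j)))
        by (intros; ring).
      rewrite rsum_plus, rsum_scal. ring.
  - apply Rmult_lt_reg_r with (C + 1); [lra|]. replace (eps / (C + 1) * C * (C + 1)) with (eps * C) by (field; lra).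
    nra.
Qed.

Definition contains_join (k s : nat) (g : nat -> nat) (E : list (list nat)) : Prop :=
  forall c : nat -> nat, (forall i, (i < k)%nat -> (c i < 3)%nat) ->
  exists e, In e E /\ (forall i, (i < k)%nat -> In (g (3 * i + c i)%nat) e) /\
    (forall j, (j < s)%nat -> In (g (3 * k + j)%nat) e).

Lemma join_point_edge k s g E x : contains_join k s g E -> join_point k s x ->
  exists e, In e E /\ forall u, (u < 3 * k + s)%nat -> x u <> 0 -> In (g u) e.
Proof.
  intros HE (_ & _ & Hx).
  (* In each block [c] picks the vertex of nonzero weight; the default 2 serves both a weight at the
     third vertex and a block without weight. *)
  set (c := fun i => if Req_dec_T (x (3 * i + 0)%nat) 0
                     then if Req_dec_T (x (3 * i + 1)%nat) 0 then 2%nat else 1%nat else 0%nat).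
  destruct (HE c) as (e & He & Hb & Hs).
  { intros i _. unfold c. repeat destruct Req_dec_T; lia. }
  exists e. split; [easy|]. intros u Hu Hxu.
  destruct (lt_dec u (3 * k)) as [Hk|Hk].
  - set (i := (u / 3)%nat). assert (Hi : (i < k)%nat) by (apply Nat.Div0.div_lt_upper_bound; lia).
    assert (Eu : (u = 3 * i + u mod 3)%nat) by (apply Nat.div_mod; lia).
    assert (Hm : (u mod 3 < 3)%nat) by (apply Nat.mod_upper_bound; lia).
    replace u with (3 * i + c i)%nat; [now apply Hb|].
    rewrite Eu at 1. f_equal. unfold c.
    assert (Hc' : forall c', (c' < 3)%nat -> c' <> (u mod 3)%nat -> x (3 * i + c')%nat = 0).
    { intros c' H1 H2. destruct (Hx i (u mod 3) c') as [H|H]; auto.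
      rewrite Eu in Hxu. contradiction. }
    repeat destruct Req_dec_T.
    + destruct (Nat.eq_dec (u mod 3) 2); [congruence|]. exfalso. apply Hxu. rewrite Eu.
      assert (Hc01 : (u mod 3 = 0 \/ u mod 3 = 1)%nat) by lia.
      destruct Hc01 as [-> | ->]; easy.
    + destruct (Nat.eq_dec (u mod 3) 1); [congruence|]. exfalso.
      specialize (Hc' 1%nat ltac:(lia)). auto.
    + destruct (Nat.eq_dec (u mod 3) 0); [congruence|]. exfalso.
      specialize (Hc' 0%nat ltac:(lia)). auto.
  - replace u with (3 * k + (u - 3 * k))%nat by lia. apply Hs. lia.
Qed.

Lemma linter_incl e1 e2 : incl (linter e1 e2) e1 /\ incl (linter e1 e2) e2.
Proof.
  unfold linter. split; intros v Hv; apply filter_In in Hv as [H1 H2]; auto.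
  destruct (in_dec Nat.eq_dec v e2); easy.
Qed.

(** The vertices of two edges together need not be affinely independent, so that [x] and [y] are
    compared through a third combination: the common image lies in the simplex of [linter e1 e2],
    whose weights agree with [x] inside [e1] and with [y] inside [e2]. *)
Lemma lin_embedding_combination_inj m E phi k s g x y :
  (forall e, In e E -> NoDup e) -> lin_embedding m E phi ->
  (forall a b, (a < 3 * k + s)%nat -> (b < 3 * k + s)%nat -> g a = g b -> a = b) ->
  contains_join k s g E -> join_point k s x -> join_point k s y ->
  veq m (combination (3 * k + s) g phi x) (combination (3 * k + s) g phi y) ->
  forall u, (u < 3 * k + s)%nat -> x u = y u.
Proof.
  intros HN [Ha Hi] Hg HE Hx Hy Hv u Hu.
  destruct (join_point_edge k s g E x HE Hx) as (e1 & He1 & Hs1).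
  destruct (join_point_edge k s g E y HE Hy) as (e2 & He2 & Hs2).
  destruct Hx as (Hx0 & Hx1 & _), Hy as (Hy0 & Hy1 & _).
  assert (C : conv m (map phi (linter e1 e2)) (combination (3 * k + s) g phi x)).
  { apply Hi; auto. split.
    - apply conv_combination; auto.
    - destruct (conv_combination m (3 * k + s) g phi y e2) as (lam & L0 & L1 & L2); auto.
      exists lam. split; [easy|split; [easy|]]. intros j Hj. rewrite Hv by exact Hj. auto. }
  destruct C as (lam & L0 & L1 & L2). rewrite length_map in *.
  destruct (linter_incl e1 e2) as [I1 I2]. set (L := linter e1 e2) in *.
  assert (L2' : veq m (combination (3 * k + s) g phi x)
     (combination (length L) (fun i => nth i L 0%nat) phi lam)).
  { intros j Hj. rewrite L2 by exact Hj. apply rsum_ext. intros i Hi'. now rewrite nth_map_phi. }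
  rewrite <- (vertex_weight_inj (3 * k + s) g x u Hg Hu).
  rewrite <- (vertex_weight_inj (3 * k + s) g y u Hg Hu).
  transitivity (vertex_weight (length L) (fun i => nth i L 0%nat) lam (g u)).
  - apply (aff_indep_vertex_weight m phi e1); auto; [|congruence].
    intros i Hi' _. now apply I1, nth_In.
  - symmetry. apply (aff_indep_vertex_weight m phi e2); auto.
    + intros i Hi' _. now apply I2, nth_In.
    + congruence.
    + intros j Hj. rewrite <- Hv by exact Hj. now apply L2'.
Qed.

Theorem PL_embeddable_no_join D d n E k s g :
  uniform_hypergraph d n E -> PL_embeddable D d E -> (2 * k + s = S (S D))%nat ->
  (forall a b, (a < 3 * k + s)%nat -> (b < 3 * k + s)%nat -> g a = g b -> a = b) ->
  ~ contains_join k s g E.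
Proof.
  intros HU (phi & Hphi & psi & _ & Hinj & Hcont & _) HD Hg HE.
  set (m := (2 * d - 1)%nat) in *.
  assert (HN : forall e, In e E -> NoDup e) by (intros e He; now apply HU).
  assert (HR : forall x, join_point k s x -> realization m E phi (combination (3 * k + s) g phi x)).
  { intros x Hx. destruct (join_point_edge k s g E x HE Hx) as (e & He & Hs).
    exists e. split; [easy|]. destruct Hx as (H0 & H1 & _). apply conv_combination; auto. }
  apply (join_not_embeddable k s D (fun x => psi (combination (3 * k + s) g phi x)) HD).
  - intros x Hx eps He.
    destruct (Hcont _ (HR x Hx) eps He) as (del & Hdel & Hd).
    destruct (combination_continuous m (3 * k + s) g phi del Hdel) as (del' & Hdel' & Hd').
    exists del'. split; [easy|]. intros y Hy Hxy j Hj.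
    rewrite Rabs_minus_sym. eapply Rle_lt_trans; [exact (coord_le_dist D (psi _) (psi _) j Hj)|].
    apply Hd; auto.
  - intros x y Hx Hy Hxy. apply (lin_embedding_combination_inj m E phi k s g); auto.
Qed.

(** * Extremal bound and coloring *)

From mathcomp Require all_boot all_order all_algebra lra ring zify Rstruct.

Module Extremal.
Import all_boot all_order all_algebra Rstruct lra ring zify.
Import Order.TTheory GRing.Theory Num.Theory.
Set Implicit Arguments.
Unset Strict Implicit.
Unset Printing Implicit Defensive.
Local Open Scope nat_scope.

(** [g] takes lists rather than tuples, so that fixing an entry does not change its type. *)
Definition tuple_sum (T : finType) (k : nat) (g : seq T -> nat) : nat :=
  \sum_(t : k.-tuple T) g t.

Lemma tuple_sumS (T : finType) k (g : seq T -> nat) :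
  tuple_sum k.+1 g = \sum_(x : T) tuple_sum k (fun t => g (x :: t)).
Proof.
rewrite /tuple_sum pair_big /=.
rewrite (reindex (fun p : T * k.-tuple T => [tuple of p.1 :: p.2])) /=.
  by apply: eq_bigr => -[].
exists (fun t : k.+1.-tuple T => (thead t, [tuple of behead t])).
  by move=> [x t] _ /=; rewrite theadE; congr (_, _); apply: val_inj.
by move=> t _ /=; rewrite [RHS]tuple_eta; apply: val_inj.
Qed.

Lemma tuple_sumSr (T : finType) k (g : seq T -> nat) :
  tuple_sum k.+1 g = tuple_sum k (fun t => \sum_(x : T) g (x :: t)).
Proof. by rewrite tuple_sumS /tuple_sum exchange_big. Qed.

Lemma uniq_triple_sum (T : finType) (P : pred T) :
  \sum_(b : 3.-tuple T | uniq b) all P b = (\sum_x P x) ^_ 3.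
Proof.
have -> : \sum_x P x = #|P| by rewrite -sum1_card [RHS]big_mkcond; apply: eq_bigr => x _; rewrite unfold_in; case: (P x).
rewrite -card_uniq_tuples -sum1_card big_mkcond [RHS]big_mkcond; apply: eq_bigr => b _.
by rewrite inE andbC; case: (uniq b); case: (all P b).
Qed.

(** * Erdos' theorem for boxes of three-element sets *)

Section Erdos.
Variables (T : finType) (F : realFieldType).
Local Open Scope ring_scope.
Implicit Types (A : pred (seq T)) (w : F).

Local Notation n := (#|T|%:R : F).

(** With a tangent as the affine minorant this takes the place of Jensen's inequality. *)
Lemma tuple_sum_affine k (g h : seq T -> nat) (a b : F) :
  (forall t, a * (g t)%:R - b <= (h t)%:R) ->
  a * (tuple_sum k g)%:R - b * n ^+ k <= (tuple_sum k h)%:R.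
Proof.
move=> gh; rewrite /tuple_sum !natr_sum mulr_sumr.
have -> : b * n ^+ k = \sum_(t : k.-tuple T) b.
  by rewrite sumr_const card_tuple -natrX mulr_natr.
by rewrite -sumrB; apply: ler_sum.
Qed.

(* The tangent at [t] of the convex function [x ^ 3], taken at [d - 2]. *)
Lemma falling_factorial3_ge (d : nat) (t : F) : 0 <= t ->
  3 * t ^+ 2 * d%:R - (6 * t ^+ 2 + 2 * t ^+ 3) <= (d ^_ 3)%:R.
Proof.
move=> t0; have t2 : 0 <= t ^+ 2 by exact: exprn_ge0.
have t3 : 0 <= t ^+ 3 by exact: exprn_ge0.
case: d => [|[|e]]; first by rewrite ffact_small // mulr0; lra.
  by rewrite ffact_small // mulr1; lra.
rewrite !ffactnS ffactn0 muln1 /= !natrM -[e.+2]addn2 -[e.+1]addn1 !natrD.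
have e0 : 0 <= e%:R :> F by exact: ler0n.
have : 0 <= (e%:R - t) ^+ 2 * (e%:R + 2 * t) by apply: mulr_ge0; [exact: sqr_ge0|lra].
have : 0 <= e%:R ^+ 2 :> F by exact: sqr_ge0.
move: (e%:R) e0 => x x0 x2 H; rewrite -subr_ge0.
have -> : (x + 2%:R) * ((x + 1%:R) * x) - (3 * t ^+ 2 * (x + 2%:R) - (6 * t ^+ 2 + 2 * t ^+ 3))
  = (x - t) ^+ 2 * (x + 2 * t) + 3 * x ^+ 2 + 2 * x by ring.
lra.
Qed.

Definition select (t : seq T) (bs : seq (3.-tuple T)) : bool :=
  all2 (fun x (b : 3.-tuple T) => x \in b) t bs.

Definition has_box k A :=
  exists bs : seq (3.-tuple T), [/\ size bs = k, all (fun b : 3.-tuple T => uniq b) bs &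
    forall t, select t bs -> A t].

(** Double counting of triples of first entries. If some triple has many common continuations, the
    induction applies to these with [w ^+ 3] and the same constant 4, which is why [3 ^ k] occurs.
    If no triple has, the convexity bound for the number of triples is violated. *)
Lemma erdos_box k A w : 1 <= w -> w ^+ (3 ^ k) <= n ->
  4 * n ^+ k.+1 < (tuple_sum k.+1 A)%:R * w -> has_box k.+1 A.
Proof.
elim: k A w => [|k IH] A w w1 wn lt.
  have n0 : 0 < n by apply: lt_le_trans wn; rewrite expr1; lra.
  rewrite expn0 !expr1 in wn lt.
  have : 4 < (tuple_sum 1 A)%:R :> F.
    rewrite -(ltr_pM2r n0); apply: (lt_le_trans lt).
    by apply: ler_wpM2l.
  rewrite ltr_nat tuple_sumS => lt4.
  have {lt4} : (0 < (\sum_x A [:: x]) ^_ 3)%N.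
    rewrite ffact_gt0; apply: leq_trans (ltnW (ltnW lt4)) _.
    apply/eq_leq/eq_bigr => x _; rewrite /tuple_sum (big_pred1 [tuple]) // => t.
    by rewrite [t]tuple0 /= eqxx.
  rewrite -(uniq_triple_sum (fun x => A [:: x])) lt0n sum_nat_eq0 negb_forall.
  case/existsP => b; rewrite negb_imply eqb0 negbK => /andP[ub /allP Ab].
  exists [:: b]; split=> //=; first by rewrite ub.
  by case=> [|x [|y t]] //=; rewrite ?andbF // andbT => /Ab.
have w0 : 0 < w by lra.
have wn1 : w <= n.
  by apply: le_trans wn; rewrite -[leLHS]expr1 ler_weXn2l // expn_gt0.
have n0 : 0 < n by apply: lt_le_trans wn1.
have w3 : 1 <= w ^+ 3 by exact: exprn_ege1.
have wn3 : (w ^+ 3) ^+ (3 ^ k) <= n by rewrite -exprM -expnS.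
pose B (b : 3.-tuple T) : pred (seq T) := fun t => all (fun x => A (x :: t)) b.
have [/existsP[b /andP[ub ltb]]|] := boolP [exists b : 3.-tuple T, uniq b &&
    (4 * n ^+ k.+1 < (tuple_sum k.+1 (B b))%:R * w ^+ 3)].
  have [bs [sbs ubs Bbs]] := IH _ _ w3 wn3 ltb.
  exists (b :: bs); split=> /=; [by rewrite sbs|by rewrite ub|].
  by case=> [|x t] //= /andP[xb /Bbs /allP/(_ x xb)].
rewrite negb_exists => /forallP no.
exfalso; pose N := n ^+ k.+1; pose D t := (\sum_x A (x :: t))%N.
have N0 : 0 < N by exact: exprn_gt0.
have upper : (tuple_sum k.+1 (fun t => (D t) ^_ 3))%:R * w ^+ 3 <= n ^+ 3 * (4 * N).
  have -> : tuple_sum k.+1 (fun t => (D t) ^_ 3) =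
      \sum_(b : 3.-tuple T | uniq b) tuple_sum k.+1 (B b).
    by rewrite /tuple_sum exchange_big; apply: eq_bigr => t _; rewrite uniq_triple_sum.
  rewrite natr_sum mulr_suml.
  have -> : n ^+ 3 * (4 * N) = \sum_(b : 3.-tuple T) (4 * N).
    by rewrite sumr_const card_tuple -natrX mulr_natl.
  rewrite [leLHS]big_mkcond; apply: ler_sum => b _; case: ifP => ub; last by lra.
  by have := no b; rewrite ub /= -leNgt.
(* Half of the value [4 * n / w] that the average of [D] exceeds. It is at least 2 since [w <= n],
   which absorbs the shift in the tangent; its cube then gives 8 against the 4 in [upper]. *)
pose t := 2 * n / w.
have t2 : 2 <= t by rewrite ler_pdivlMr //; lra.
have tw : t * w = 2 * n by rewrite divfK // gt_eqF.
have lower := @tuple_sum_affine k.+1 D (fun t => (D t) ^_ 3) _ _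
  (fun s => falling_factorial3_ge (D s) (le_trans (ler0n _ 2) t2)).
rewrite tuple_sumSr -/D exprS -/N in lt; rewrite -/N in lower.
set M := (tuple_sum _ D)%:R in lt lower.
set Q := (tuple_sum _ _)%:R in lower upper.
have Mt : 2 * t * N < M.
  rewrite -(ltr_pM2r w0); apply: le_lt_trans lt.
  by rewrite mulrAC -(mulrA 2) tw; lra.
have tN : 0 <= t ^+ 2 * ((t - 2) * N).
  by apply: mulr_ge0; [exact: sqr_ge0 | apply: mulr_ge0; lra].
have tM : 0 <= t ^+ 2 * (M - 2 * t * N) by apply: mulr_ge0; [exact: sqr_ge0 | lra].
have QN : t ^+ 3 * N <= Q.
  apply: le_trans lower; rewrite -subr_ge0.
  have -> : 3 * t ^+ 2 * M - (6 * t ^+ 2 + 2 * t ^+ 3) * N - t ^+ 3 * N =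
    3 * (t ^+ 2 * (M - 2 * t * N)) + 3 * (t ^+ 2 * ((t - 2) * N)) by ring.
  lra.
have : 8 * (n ^+ 3 * N) <= 4 * (n ^+ 3 * N).
  have tw3 : t ^+ 3 * w ^+ 3 = 8 * n ^+ 3 by rewrite -exprMn tw; ring.
  have -> : 8 * (n ^+ 3 * N) = t ^+ 3 * N * w ^+ 3 by rewrite mulrA -tw3; ring.
  have -> : 4 * (n ^+ 3 * N) = n ^+ 3 * (4 * N) by ring.
  by apply: le_trans upper; rewrite ler_pM2r // exprn_gt0.
have : 0 < n ^+ 3 * N by rewrite mulr_gt0 // exprn_gt0.
lra.
Qed.

(** The first [s] entries are fixed one after the other by averaging, at no loss in [w]. *)
Lemma erdos_box_cone s k A w : 1 <= w -> w ^+ (3 ^ k) <= n ->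
  4 * n ^+ (s + k.+1) < (tuple_sum (s + k.+1) A)%:R * w ->
  exists ss : seq T, size ss = s /\ has_box k.+1 (fun t => A (ss ++ t)).
Proof.
move=> w1 wn; have w0 : 0 < w by lra.
elim: s A => [|s IH] A lt; first by exists [::]; split=> //; exact: erdos_box lt.
have [/existsP[x ltx]|] := boolP [exists x : T,
    4 * n ^+ (s + k.+1) < (tuple_sum (s + k.+1) (fun t => A (x :: t)))%:R * w].
  by have [ss [sss box]] := IH _ ltx; exists (x :: ss); rewrite /= sss.
rewrite negb_exists => /forallP no; move: lt.
rewrite addSn tuple_sumS natr_sum mulr_suml ltNge => /negP[].
have -> : 4 * n ^+ (s + k.+1).+1 = \sum_(x : T) 4 * n ^+ (s + k.+1).
  by rewrite sumr_const -[RHS]mulr_natr -mulrA -exprSr.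
by apply: ler_sum => x _; rewrite leNgt.
Qed.
End Erdos.

(** * Degrees and ordered link tuples *)

Section Degree.
Variables (T : finType) (E : {set {set T}}).

Definition degree (v : T) : nat := #|[set e in E | v \in e]|.

Definition link_tuple (v : T) (t : seq T) : bool :=
  uniq (v :: t) && ([set x in v :: t] \in E).

Lemma degree_fact r v : (forall e, e \in E -> #|e| = r.+1) ->
  degree v * r`! <= tuple_sum r (link_tuple v).
Proof.
move=> Er; rewrite /degree -sum1_card big_distrl /=.
have card_link e : e \in [set e in E | v \in e] -> #|e :\ v| = r.
  rewrite inE => /andP[eE ve]; apply/eqP.
  by rewrite -eqSS -(Er e eE) (cardsD1 v e) ve.
rewrite (eq_bigr (fun e : {set T} => \sum_(t : r.-tuple T) (all (mem (e :\ v)) t && uniq t))); last first.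
  move=> e He; rewrite mul1n -ffactnn -{1}(card_link e He) -card_uniq_tuples -sum1_card.
  by rewrite big_mkcond; apply: eq_bigr => t _; rewrite inE; case: ifP.
rewrite exchange_big; apply: leq_sum => t _; pose e0 := [set x in v :: t].
apply: (@leq_trans (\sum_(e in [set e in E | v \in e]) (e == e0) * link_tuple v t)).
  apply: leq_sum => e He; case: andP => // -[/allP te ut].
  have vt : v \notin t by apply/negP => /te; rewrite inE /= setD11.
  have [eE ve] : e \in E /\ v \in e by move: He; rewrite inE => /andP[].
  have e0e : e0 = e.
    apply/eqP; rewrite eqEcard (Er e eE); apply/andP; split.
      apply/subsetP => x; rewrite !inE => /orP[/eqP-> //|/te].
      by rewrite inE => /setD1P[].
    by rewrite cardsE (card_uniqP _) /= ?size_tuple ?vt.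
  by rewrite e0e eqxx /link_tuple cons_uniq vt ut -/e0 e0e eE.
rewrite -big_distrl /= -[leqRHS]mul1n leq_mul2r; apply/orP; right.
have -> : \sum_(e in [set e in E | v \in e]) (e == e0) =
  \sum_(e in [set e in E | v \in e] | e == e0) 1 by rewrite big_mkcondr.
by rewrite sum1_card -(card1 e0); apply/subset_leq_card/subsetP => e; rewrite !inE => /andP[].
Qed.
End Degree.

(** * Rosenfeld's counting of weak colorings *)

Section Rosenfeld.
Variables (T : finType) (E : {set {set T}}) (c q Delta : nat).
Hypothesis q_gt0 : 0 < q.
Hypothesis E_unif : forall e, e \in E -> #|e| = q.+2.
Hypothesis E_deg : forall v, degree E v <= Delta.
Hypothesis Delta_le : Delta * q.+1 ^ q.+1 <= c.+1 ^ q.+1 * q ^ q.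
Implicit Types (S U W e : {set T}) (f g : {ffun T -> 'I_c.+1}).

Definition monochromatic f e := [forall x in e, forall y in e, f x == f y].

Lemma monochromaticP f e :
  reflect {in e &, forall x y, f x = f y} (monochromatic f e).
Proof.
apply: (iffP forall_inP) => [H x y xe ye|H x xe]; first exact/eqP/(forall_inP (H x xe)).
by apply/forall_inP => y ye; apply/eqP/H.
Qed.

Definition proper_on S f := [forall e in E, (e \subset S) ==> ~~ monochromatic f e].

Lemma proper_onP S f :
  reflect (forall e, e \in E -> e \subset S -> ~~ monochromatic f e) (proper_on S f).
Proof.
apply: (iffP forall_inP) => [H e eE eS|H e eE]; first exact: (implyP (H e eE)).
by apply/implyP => eS; exact: H.
Qed.

(** A coloring of [S] is encoded as a function on all of [T] with a default color outside [S], so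
    that colorings of different sets are counted in one finite type. *)
Definition supported S f := [forall x, (x \notin S) ==> (f x == ord0)].

Lemma supportedP S f : reflect (forall x, x \notin S -> f x = ord0) (supported S f).
Proof.
apply: (iffP forallP) => [H x xS|H x]; first exact/eqP/(implyP (H x)).
by apply/implyP => xS; apply/eqP/H.
Qed.

Definition colorings S := [set f | supported S f && proper_on S f].

Definition extensions S v := [set f | supported (v |: S) f && proper_on S f].

Definition bad_extensions S v e :=
  [set f in extensions S v | (e \subset v |: S) && monochromatic f e].

Lemma card_extensions S v : v \notin S -> c.+1 * #|colorings S| <= #|extensions S v|.
Proof.
move=> vS.
pose h (p : {ffun T -> 'I_c.+1} * 'I_c.+1) : {ffun T -> 'I_c.+1} :=
  [ffun x => if x == v then p.2 else p.1 x].
have hinj : {in setX (colorings S) setT &, injective h}.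
  move=> [f a] [g b] /=; rewrite !inE /= !andbT.
  move=> /andP[/supportedP fS _] /andP[/supportedP gS _] /ffunP hh.
  congr (_, _); last by have := hh v; rewrite !ffunE eqxx.
  apply/ffunP => x; have := hh x; rewrite !ffunE.
  by case: eqP => // -> _; rewrite fS ?gS.
have <- : #|setX (colorings S) [set: 'I_c.+1]| = c.+1 * #|colorings S|.
  by rewrite cardsX cardsT card_ord mulnC.
rewrite -(card_in_imset hinj); apply/subset_leq_card/subsetP => _ /imsetP[[f a] /= + ->].
rewrite !inE /= andbT => /andP[/supportedP fS /proper_onP fP]; apply/andP; split.
  apply/supportedP => x; rewrite !inE negb_or ffunE => /andP[/negPf-> xS]; exact: fS.
apply/proper_onP => e eE eS; apply: contra (fP e eE eS) => /monochromaticP H.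
apply/monochromaticP => x y xe ye; have := H x y xe ye; rewrite !ffunE /=.
have ne z : z \in e -> (z == v) = false.
  by move=> ze; apply: contraNF vS => /eqP <-; exact: (subsetP eS).
by rewrite !ne.
Qed.

Lemma card_extensions_le S v :
  #|extensions S v| <= #|colorings (v |: S)| +
    \sum_(e in [set e in E | v \in e]) #|bad_extensions S v e|.
Proof.
rewrite -!sum1_card big_mkcond [X in X + _]big_mkcond.
rewrite (eq_bigr (fun e => \sum_f (f \in bad_extensions S v e : nat))); last first.
  by move=> e _; rewrite -sum1_card big_mkcond; apply: eq_bigr => f _; case: ifP.
rewrite exchange_big -big_split /=; apply: leq_sum => f _.
case: ifP => // fE; case: ifP => // fC; rewrite add0n.
have : ~~ proper_on (v |: S) f.
  by move: fE fC; rewrite !inE => /andP[-> _] /= ->.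
case/forall_inPn => e eE; rewrite negb_imply negbK => /andP[eS me].
have ve : v \in e.
  apply: contraTT me => ve; move: fE; rewrite inE => /andP[_ /proper_onP]; apply=> //.
  by move: eS; rewrite -subDset (setDidPl _) // disjoint_sym disjoints1.
rewrite (bigD1 e) /=; last by rewrite inE eE ve.
by rewrite [f \in bad_extensions _ _ _]inE fE eS me.
Qed.

(** On a monochromatic [e] the color of a single vertex other than [v] gives back all the others, so
    that [v] and the [q] vertices of [U] can be forgotten. *)
Lemma card_bad_extensions S v e : e \in E -> v \in e -> v \notin S -> e \subset v |: S ->
  exists U, [/\ U \subset S, #|U| = q & #|bad_extensions S v e| <= #|colorings (S :\: U)|].
Proof.
move=> eE ve vS eS.
have [w] : exists w, w \in e :\ v.
  by apply/set0Pn; rewrite -card_gt0; have := E_unif eE; rewrite (cardsD1 v e) ve add1n => -[->].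
rewrite !inE => /andP[wv we]; exists (e :\ v :\ w).
have wS : w \in S by move: (subsetP eS w we); rewrite !inE (negPf wv).
split.
- apply/subsetP => x; rewrite !inE => /and3P[_ xv xe].
  by move: (subsetP eS x xe); rewrite !inE (negPf xv).
- by have := E_unif eE; rewrite (cardsD1 v e) ve (cardsD1 w (e :\ v)) !inE wv we => -[].
set W := S :\: _.
have inW x : x \in W = (x \in S) && ((x == w) || (x \notin e)).
  rewrite !inE andbC; case xS: (x \in S) => //=; rewrite !negb_and negbK.
  by have -> : x != v by apply: contraNneq vS => <-.
pose h f : {ffun T -> 'I_c.+1} := [ffun x => if x \in W then f x else ord0].
have hW f x : x \in W -> h f x = f x by move=> xW; rewrite ffunE xW.
have hinj : {in bad_extensions S v e &, injective h}.
  move=> f g; rewrite !inE => /and3P[/andP[/supportedP fS _] _ /monochromaticP fe].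
  move=> /and3P[/andP[/supportedP gS _] _ /monochromaticP ge] /ffunP fg.
  have fgW x : x \in W -> f x = g x by move=> xW; have := fg x; rewrite !hW.
  apply/ffunP => x; have [xe|xe] := boolP (x \in e).
    by rewrite (fe x w) // (ge x w) // fgW // inW wS eqxx.
  have [xS|xS] := boolP (x \in S); first by rewrite fgW // inW xS xe orbT.
  have xvS : x \notin v |: S by rewrite !inE negb_or xS andbT; apply: contraNneq xe => ->.
  by rewrite fS ?gS.
rewrite -(card_in_imset hinj); apply/subset_leq_card/subsetP => _ /imsetP[f + ->].
rewrite !inE => /andP[/andP[_ /proper_onP fP] _]; apply/andP; split.
  by apply/supportedP => x xW; rewrite ffunE (negPf xW).
apply/proper_onP => e' e'E e'W; apply: contra (fP e' e'E (subset_trans e'W (subsetDl _ _))).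
move=> /monochromaticP H; apply/monochromaticP => x y xe ye.
by have := H x y xe ye; rewrite !hW //; exact: (subsetP e'W).
Qed.

(** Relative to the growth step for sets smaller than [m], so that it can be used inside the
    induction that proves this step. *)
Lemma colorings_mul m : (forall S v, #|S| < m -> v \notin S ->
    c.+1 * q * #|colorings S| <= q.+1 * #|colorings (v |: S)|) ->
  forall j S U, #|S| <= m -> U \subset S -> #|U| = j ->
    (c.+1 * q) ^ j * #|colorings (S :\: U)| <= q.+1 ^ j * #|colorings S|.
Proof.
move=> IH; elim=> [|j IHj] S U Sm US Uj.
  by rewrite (cards0_eq Uj) setD0 !expn0.
have [u uU] : exists u, u \in U by apply/set0Pn; rewrite -card_gt0 Uj.
have uS := subsetP US u uU.
have S'm : #|S :\ u| < m by move: Sm; rewrite (cardsD1 u S) uS.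
have := IH (S :\ u) u S'm; rewrite !inE eqxx setD1K // => /(_ isT) step.
have : (c.+1 * q) ^ j * #|colorings ((S :\ u) :\: (U :\ u))| <=
       q.+1 ^ j * #|colorings (S :\ u)|.
  apply: IHj; [exact: ltnW | exact: setSD |].
  by move: Uj; rewrite (cardsD1 u U) uU => -[].
have -> : (S :\ u) :\: (U :\ u) = S :\: U.
  by apply/setP => x; rewrite !inE; case: (eqVneq x u) => [->|//]; rewrite uU andbF.
rewrite !expnS => IHX.
apply: (@leq_trans (c.+1 * q * (q.+1 ^ j * #|colorings (S :\ u)|))).
  by rewrite -[leqLHS]mulnA leq_mul2l IHX orbT.
by rewrite mulnCA -[leqRHS]mulnA [leqRHS]mulnCA leq_mul2l step orbT.
Qed.

(** With [N] colorings of [S] there are [c.+1 * N] extensions, and each edge at [v] spoils at most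
    [(q.+1 / (c.+1 * q)) ^ q * N] of them. By the bound on [Delta] all edges together spoil at most
    the fraction [1 / q.+1]. Denominators are multiplied out. *)
Lemma colorings_step m S v : #|S| < m -> v \notin S ->
  c.+1 * q * #|colorings S| <= q.+1 * #|colorings (v |: S)|.
Proof.
elim: m S v => [//|m IH] S v; rewrite ltnS => Sm vS.
have bad e : e \in [set e in E | v \in e] ->
    (c.+1 * q) ^ q * #|bad_extensions S v e| <= q.+1 ^ q * #|colorings S|.
  rewrite inE => /andP[eE ve]; have [eS|eS] := boolP (e \subset v |: S); last first.
    rewrite (_ : bad_extensions S v e = set0) ?cards0 ?muln0 //.
    by apply/setP => f; rewrite !inE (negPf eS) andbF.
  have [U [US Uq Ub]] := card_bad_extensions eE ve vS eS.
  have := colorings_mul IH Sm US Uq; apply: leq_trans.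
  by rewrite leq_mul2l Ub orbT.
have sum_bad : (c.+1 * q) ^ q * \sum_(e in [set e in E | v \in e]) #|bad_extensions S v e| <=
    Delta * (q.+1 ^ q * #|colorings S|).
  rewrite big_distrr /=.
  apply: (@leq_trans (\sum_(e in [set e in E | v \in e]) q.+1 ^ q * #|colorings S|)).
    exact: leq_sum.
  by rewrite sum_nat_const leq_mul2r; apply/orP; right; exact: E_deg.
have := card_extensions vS; have := card_extensions_le S v.
move: sum_bad; set B := \sum_(_ in _) _; set N := #|colorings S|.
set N' := #|colorings _| => sum_bad le1 le2.
have : q.+1 * B <= c.+1 * N.
  have X0 : 0 < (c.+1 * q) ^ q by rewrite expn_gt0 muln_gt0 q_gt0.
  rewrite -(leq_pmul2l X0).
  apply: (@leq_trans (q.+1 * (Delta * (q.+1 ^ q * N)))).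
    by rewrite mulnCA leq_mul2l sum_bad orbT.
  have -> : q.+1 * (Delta * (q.+1 ^ q * N)) = Delta * q.+1 ^ q.+1 * N by rewrite expnS; ring.
  have -> : (c.+1 * q) ^ q * (c.+1 * N) = c.+1 ^ q.+1 * q ^ q * N.
    by rewrite expnMn expnS; ring.
  by rewrite leq_mul2r Delta_le orbT.
have : q.+1 * (c.+1 * N) <= q.+1 * (N' + B).
  by rewrite leq_mul2l (leq_trans le2 le1) orbT.
rewrite mulnDr [leqLHS]mulSn [c.+1 * q]mulnC -[q * _ * _]mulnA.
move: (q.+1 * N') (q.+1 * B) (c.+1 * N) (q * _); lia.
Qed.

Lemma colorings_gt0 S : 0 < #|colorings S|.
Proof.
have [m] := ubnP #|S|; elim: m S => // m IH S Sm.
have [->|[v vS]] := set_0Vmem S.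
  rewrite card_gt0; apply/set0Pn; exists [ffun => ord0]; rewrite inE; apply/andP; split.
    by apply/supportedP => x _; rewrite ffunE.
  apply/proper_onP => e eE; rewrite subset0 => /eqP e0.
  by have := E_unif eE; rewrite e0 cards0.
have S'm : #|S :\ v| < m by move: Sm; rewrite (cardsD1 v S) vS.
have := @colorings_step m (S :\ v) v S'm; rewrite !inE eqxx setD1K // => /(_ isT) step.
have : 0 < q.+1 * #|colorings S|.
  by apply: leq_trans step; rewrite !muln_gt0 q_gt0 IH.
by rewrite muln_gt0.
Qed.

Theorem weak_coloring_exists :
  exists f : {ffun T -> 'I_c.+1}, forall e, e \in E ->
    exists u w, [/\ u \in e, w \in e & f u != f w].
Proof.
have := colorings_gt0 setT; rewrite card_gt0 => /set0Pn[f].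
rewrite inE => /andP[_ /proper_onP fP]; exists f => e eE.
case/forall_inPn: (fP e eE (subsetT e)) => u ue /forall_inPn[w we uw].
by exists u, w.
Qed.
End Rosenfeld.

Lemma box_or_coloring (F : realFieldType) (T : finType) (E : {set {set T}})
    (s k q c : nat) (w : F) :
  0 < q -> q.+1 = s + k.+1 -> (forall e, e \in E -> #|e| = q.+2) ->
  (1 <= w)%R -> (w ^+ (3 ^ k) <= #|T|%:R)%R ->
  (4 * #|T|%:R ^+ q.+1 * (q.+1 ^ q.+1)%:R <= w * (c.+1 ^ q.+1 * q ^ q * q.+1`!)%:R)%R ->
  (exists v ss, size ss = s /\ has_box k.+1 (fun t => link_tuple E v (ss ++ t))) \/
  exists f : {ffun T -> 'I_c.+1}, forall e, e \in E ->
    exists u w, [/\ u \in e, w \in e & f u != f w].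
Proof.
move=> q0 qsk Eu w1 wn H.
have w0 : (0 < w)%R by lra.
have [/existsP[v lt]|] := boolP [exists v,
    (4 * #|T|%:R ^+ (s + k.+1) < (tuple_sum (s + k.+1) (link_tuple E v))%:R * w)%R].
  left; exists v; exact: erdos_box_cone w1 wn lt.
rewrite negb_exists => /forallP no; right.
apply: (@weak_coloring_exists T E c q ((c.+1 ^ q.+1 * q ^ q) %/ q.+1 ^ q.+1)) => //; last first.
  exact: leq_trunc_div.
move=> v; rewrite leq_divRL ?expn_gt0 // -(@leq_pmul2r q.+1`!) ?fact_gt0 //.
rewrite -(ler_nat F) -(ler_pM2l w0); apply: le_trans H.
have := no v; rewrite -leNgt -qsk => le1.
have le2 := @degree_fact T E q.+1 v Eu; rewrite -(ler_nat F) in le2.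
rewrite mulnAC natrM mulrA [leRHS]mulrC [leLHS]mulrC; apply: ler_wpM2l; first exact: ler0n.
by apply: le_trans le1; rewrite [leLHS]mulrC ler_wpM2r // ltW.
Qed.

(** * From finite sets back to lists of numbers *)

Lemma InE (x : nat) (l : seq nat) : List.In x l <-> x \in l.
Proof.
elim: l => [|y l IH] //=; rewrite inE; split.
  by move=> [->|/IH ->]; rewrite ?eqxx ?orbT.
by move=> /orP[/eqP->|/IH]; [left|right].
Qed.

Lemma NoDup_uniq (l : seq nat) : List.NoDup l -> uniq l.
Proof.
elim: l => [|x l IH] //= H; inversion H; subst; rewrite IH // andbT.
by apply/negP => /InE.
Qed.

Section Bridge.
Variables (n : nat) (v : 'I_n) (ss : seq 'I_n) (bs : seq (3.-tuple 'I_n)).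
Let k := size bs.
Let s := (size ss).+1.

Definition block (i : nat) : 3.-tuple 'I_n := nth [tuple v; v; v] bs i.

(* The vertices of the boxes first, then those of the simplex, as in [join_point]. *)
Definition join_vertex (u : nat) : nat :=
  if u < 3 * k then val (nth v (block (u %/ 3)) (u %% 3)) else val (nth v (v :: ss) (u - 3 * k)).

Definition selection (c : nat -> nat) : seq 'I_n :=
  (v :: ss) ++ mkseq (fun i => nth v (block i) (c i)) k.

(** A selection lists the simplex before the blocks, as the link tuples do, whereas [join_vertex]
    numbers the blocks first. *)
Definition join_position (u : nat) : nat := if u < 3 * k then s + u %/ 3 else u - 3 * k.

Lemma join_vertexE c u : u < 3 * k + s -> (u < 3 * k -> c (u %/ 3) = u %% 3) ->
  join_vertex u = val (nth v (selection c) (join_position u)).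
Proof.
rewrite /join_vertex /join_position /selection => us; case: ifP => uk H.
  rewrite nth_cat /= ltnNge -/s leq_addr /= addKn nth_mkseq ?H //.
  by rewrite ltn_divLR // mulnC.
by rewrite nth_cat /= -/s ifT //; lia.
Qed.

Lemma join_position_lt u : u < 3 * k + s -> join_position u < s + k.
Proof. by rewrite /join_position => us; case: ifP => uk; rewrite ?ltn_add2l ?ltn_divLR //; lia. Qed.

Lemma size_selection c : size (selection c) = s + k.
Proof. by rewrite size_cat size_mkseq. Qed.

Lemma select_selection c : (forall i, i < k -> c i < 3) ->
  select (mkseq (fun i => nth v (block i) (c i)) k) bs.
Proof.
move=> c3; rewrite /select all2E size_mkseq eqxx /=.
apply/(all_nthP (v, [tuple v; v; v])) => i; rewrite size_zip size_mkseq minnn => ik.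
rewrite nth_zip ?size_mkseq //= nth_mkseq // -/(block i).
by apply: mem_nth; rewrite size_tuple; exact: c3.
Qed.

Variable E : {set {set 'I_n}}.
Hypothesis Ebs : forall t, select t bs -> link_tuple E v (ss ++ t).

Lemma join_vertex_selection c : (forall i, i < k -> c i < 3) ->
  exists2 e, e \in E & (forall i, i < k -> exists2 x : 'I_n, x \in e & val x = join_vertex (3 * i + c i)) /\
    (forall j, j < s -> exists2 x : 'I_n, x \in e & val x = join_vertex (3 * k + j)).
Proof.
move=> c3; have /andP[_] := Ebs (select_selection c3); rewrite -cat_cons -/(selection c) => eE.
exists [set x in selection c] => //.
have mem u : u < 3 * k + s -> (u < 3 * k -> c (u %/ 3) = u %% 3) ->
    exists2 x : 'I_n, x \in [set x in selection c] & val x = join_vertex u.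
  move=> us uc; exists (nth v (selection c) (join_position u)); last by rewrite (join_vertexE us uc).
  by rewrite inE mem_nth // size_selection join_position_lt.
split=> i ik; apply: mem.
- by have := c3 i ik; lia.
- by move=> _; have := c3 i ik => c3i; rewrite mulnC divnMDl // divn_small // addn0 modnMDl modn_small.
- by rewrite ltn_add2l.
- by rewrite ltnNge leq_addr.
Qed.
Hypothesis ubs : all (fun b : 3.-tuple 'I_n => uniq b) bs.

Lemma join_vertex_inj a b : a < 3 * k + s -> b < 3 * k + s ->
  join_vertex a = join_vertex b -> a = b.
Proof.
move=> ha hb ab.
have [/and3P[ak bk /eqP dab]|dab] := boolP [&& a < 3 * k, b < 3 * k & a %/ 3 == b %/ 3].
  move: ab; rewrite /join_vertex ak bk dab => /val_inj/eqP.
  have ub : uniq (block (b %/ 3)).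
    by apply: (allP ubs); apply: mem_nth; rewrite ltn_divLR // mulnC.
  rewrite nth_uniq ?size_tuple ?ltn_pmod // => /eqP mab.
  by rewrite (divn_eq a 3) (divn_eq b 3) dab mab.
(* A single selection that contains both vertices; as part of a link tuple it has no repetition. Two
   vertices of the same block, which no selection contains, were settled before by [ubs]. *)
pose c i := if (a < 3 * k) && (i == a %/ 3) then a %% 3 else b %% 3.
have c3 i : i < k -> c i < 3 by rewrite /c; case: ifP => _ _; exact: ltn_pmod.
have /andP[] := Ebs (select_selection c3); rewrite -cat_cons -/(selection c) => usel _.
move: ab; rewrite (join_vertexE (c := c) ha) ?(join_vertexE (c := c) hb).
- move=> /val_inj/eqP; rewrite nth_uniq ?size_selection ?join_position_lt //.
  move: dab; rewrite /join_position; case: ifP => ak; case: ifP => bk /=.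
  + by rewrite eqn_add2l => /negPf->.
  + by move=> _ /eqP; move: (a %/ 3); lia.
  + by move=> _ /eqP; move: (b %/ 3); lia.
  + by move=> _ /eqP; lia.
- move=> bk; rewrite /c; case: ifP => // /andP[ak /eqP ba].
  by move: dab; rewrite ak bk ba eqxx.
- by move=> ak; rewrite /c ak eqxx.
Qed.

End Bridge.

(** The simplex has [S s] vertices because the center of the link joins the [s] vertices fixed by
    averaging. *)
Theorem join_or_weak_coloring (n s k q c : nat) (E : list (list nat)) (w : R) :
  lt 0 q -> S q = (s + S k)%coq_nat -> uniform_hypergraph (S (S q)) n E ->
  Rle 1 w -> Rle (pow w (Nat.pow 3 k)) (INR n) ->
  Rle (Rmult (Rmult (INR 4) (pow (INR n) (S q))) (pow (INR (S q)) (S q)))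
      (Rmult w (Rmult (Rmult (pow (INR (S c)) (S q)) (pow (INR q) q)) (INR (Factorial.fact (S q))))) ->
  (exists g : nat -> nat,
     (forall a b, lt a (3 * S k + S s)%coq_nat -> lt b (3 * S k + S s)%coq_nat -> g a = g b -> a = b) /\
     contains_join (S k) (S s) g E) \/
  exists kappa, weak_coloring n E (S c) kappa.
Proof.
move=> /ssrnat.ltP q0 qsk Eu w1 wn H.
pose ES : {set {set 'I_n}} := [set e | has (fun l : seq nat => e == [set i | val i \in l]) E].
have ESP e : e \in ES -> exists2 l, List.In l E & e = [set i : 'I_n | val i \in l].
  rewrite inE => /hasP[l lE /eqP->]; exists l => //.
  elim: (E) lE => //= a L IH; rewrite inE => /orP[/eqP->|/IH]; [by left|by right].
have cardES l : List.In l E -> #|[set i : 'I_n | val i \in l]| = q.+2.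
  move=> /Eu[/NoDup_uniq ul [<- ln]].
  have -> : length l = size l by [].
  rewrite cardE -(size_map val); apply/perm_size/uniq_perm => //.
    by rewrite map_inj_uniq ?enum_uniq //; exact: val_inj.
  move=> x; apply/mapP/idP => [[i + ->]|xl]; first by rewrite mem_enum inE.
  have /InE/ln/ssrnat.ltP xn := xl; exists (Ordinal xn) => //.
  by rewrite mem_enum inE.
have [||||||[v [ss [sss [bs [sbs ubs Ebs]]]]]|[f fE]] :=
  @box_or_coloring R 'I_n ES s k q c w.
- exact: q0.
- exact: qsk.
- by move=> e /ESP[l lE ->]; exact: cardES.
- exact/RleP.
- move/RleP: wn; rewrite RpowE INRE card_ord.
  by have -> : Nat.pow 3 k = 3 ^ k by elim: k {qsk} => //= k ->; rewrite expnS; lia.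
- move/RleP: H; rewrite !RpowE !INRE card_ord.
  have -> : Factorial.fact q.+1 = q.+1`! by elim: (q.+1) => //= m ->; rewrite factS; lia.
  by rewrite 2!natrM !natrX.
- left; exists (join_vertex v ss bs); split.
    move=> a b /ssrnat.ltP ha /ssrnat.ltP hb; apply: (join_vertex_inj Ebs ubs); rewrite ?sbs ?sss //.
  move=> c' c3.
  have c3' i : i < size bs -> c' i < 3 by rewrite sbs => /ssrnat.ltP /c3 /ssrnat.ltP.
  have [e /ESP[l lE ->] [H1 H2]] := join_vertex_selection Ebs c3'.
  exists l; split=> //; split=> [i /ssrnat.ltP ik|j /ssrnat.ltP js].
    have [|x + <-] := H1 i; first by rewrite sbs.
    by rewrite inE => /InE.
  have [|x + xj] := H2 j; first by rewrite sss.
  by rewrite inE xj sbs => /InE.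
- right; exists (fun x => if insub x is Some i then (f i).+1 else 1); split.
    move=> x /ssrnat.ltP xn; rewrite insubT /=; have := ltn_ord (f (Sub x xn)).
    by move: (f _ : nat); lia.
  move=> l lE; have [|u [w' [ul wl fuw]]] := fE [set i | val i \in l].
    rewrite inE; apply/hasP; exists l => //.
    elim: (E) lE => //= a L IH [->|/IH]; rewrite inE ?eqxx // => ->; exact: orbT.
  exists (val u), (val w'); move: ul wl; rewrite !inE => /InE ul /InE wl; split=> //; split=> //.
  by rewrite !valK => -[] /val_inj/eqP; exact/negP.
Qed.

End Extremal.

(** * The numerical bound *)

Lemma exp_pow_INR x n : exp x ^ n = exp (INR n * x).
Proof.
  induction n as [|n IH]; [simpl; now rewrite Rmult_0_l, exp_0|].
  rewrite S_INR, Rmult_plus_distr_r, Rmult_1_l, exp_plus, <- IH. simpl. ring.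
Qed.

(** The value 8/3 is exactly what [rosenfeld_constant] requires for [q = 1]. *)
Lemma exp_1_ge : 8 / 3 <= exp 1.
Proof.
  assert (H : 1 + / 32 <= exp (/ 32)) by apply exp_ineq1_le.
  replace (exp 1) with (exp (/ 32) ^ 32).
  - apply Rle_trans with ((1 + / 32) ^ 32); [lra|]. apply pow_incr. lra.
  - rewrite exp_pow_INR. f_equal. simpl. lra.
Qed.

Lemma succ_pow_le_exp (q : nat) : (0 < q)%nat -> INR (S q) ^ q <= exp 1 * INR q ^ q.
Proof.
  intros Hq. assert (Hq0 : 0 < INR q) by now apply lt_0_INR.
  replace (INR (S q)) with ((1 + / INR q) * INR q) by (rewrite S_INR; field; lra).
  rewrite Rpow_mult_distr. apply Rmult_le_compat_r; [apply pow_le; lra|].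
  replace (exp 1) with (exp (/ INR q) ^ q).
  - apply pow_incr. pose proof (Rinv_0_lt_compat _ Hq0). split; [lra|apply exp_ineq1_le].
  - rewrite exp_pow_INR. f_equal. field. lra.
Qed.

(** Divided by [q + 1], the claim follows for [q >= 2] from [(1 + 1/q)^q <= e] and [4 <= q + 2]; for
    [q = 1] it reads [8 <= 3 e]. *)
Lemma rosenfeld_constant (q : nat) : (0 < q)%nat ->
  4 * INR (S q) ^ S q <= exp 1 * INR (S (S q)) * (INR q ^ q * INR (Factorial.fact (S q))).
Proof.
  intros Hq. pose proof exp_1_ge as He.
  assert (Hf : 1 <= INR (Factorial.fact q)) by (apply (le_INR 1), lt_O_fact).
  assert (Hqq : 0 <= INR q ^ q) by (apply pow_le, pos_INR).
  change (Factorial.fact (S q)) with (S q * Factorial.fact q)%nat.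
  rewrite mult_INR, <- tech_pow_Rmult.
  replace (4 * (INR (S q) * INR (S q) ^ q)) with (INR (S q) * (4 * INR (S q) ^ q)) by ring.
  replace (exp 1 * INR (S (S q)) * (INR q ^ q * (INR (S q) * INR (Factorial.fact q)))) with
    (INR (S q) * (exp 1 * INR q ^ q * (INR (S (S q)) * INR (Factorial.fact q)))) by ring.
  apply Rmult_le_compat_l; [apply pos_INR|].
  destruct (Nat.eq_dec q 1) as [->|Hq1].
  - simpl. lra.
  - apply Rle_trans with (exp 1 * INR q ^ q * 4).
    + pose proof (succ_pow_le_exp q Hq). lra.
    + apply Rmult_le_compat_l; [apply Rmult_le_pos; lra|].
      assert (4 <= INR (S (S q))) by (replace 4 with (INR 4) by (simpl; ring); apply le_INR; lia).
      nra.
Qed.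

Lemma Rceil_ge x : x <= IZR (Rceil x).
Proof.
  unfold Rceil. rewrite opp_IZR. pose proof (base_Int_part (- x)). lra.
Qed.

Lemma coloring_number_pow (r m : nat) (a eps : R) : (0 < r)%nat -> (0 < m)%nat -> 0 < a ->
  (Rpower a (/ INR r) * Rpower (INR m) (1 - eps / INR r)) ^ r * Rpower (INR m) eps = a * INR m ^ r.
Proof.
  intros Hr Hm Ha. apply lt_0_INR in Hr, Hm.
  rewrite Rpow_mult_distr, <- !Rpower_pow by (try apply exp_pos; easy).
  rewrite !Rpower_mult, Rmult_assoc, <- Rpower_plus.
  replace (/ INR r * INR r) with 1 by (field; lra).
  replace ((1 - eps / INR r) * INR r + eps) with (INR r) by (field; lra).
  now rewrite Rpower_1.
Qed.

Theorem mainTheorem15 (d l n : nat) (E : list (list nat)) :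
  (3 <= l)%nat -> (l <= d)%nat ->
  uniform_hypergraph d n E ->
  PL_embeddable (2 * d - l) d E ->
  exists (c : nat) (kappa : nat -> nat),
    weak_coloring n E c kappa /\
    (Z.of_nat c <=
      Rceil (Rpower (exp 1 * INR d) (/ INR (d - 1)) *
             Rpower (INR n) (1 - (/ 3 ^ (d + 1 - l)) / INR (d - 1))))%Z.
Proof.
  intros Hl Hd HU HPL.
  set (eps := / 3 ^ (d + 1 - l)).
  set (X := Rpower (exp 1 * INR d) (/ INR (d - 1)) * Rpower (INR n) (1 - eps / INR (d - 1))).
  assert (HX : 0 < X) by (apply Rmult_lt_0_compat; apply exp_pos).
  assert (HcX := Rceil_ge X).
  assert (Hc0 : (0 < Rceil X)%Z) by (apply lt_IZR; lra).
  (* Without vertices there are no edges, as these have [d >= 3] vertices; otherwise [1 <= INR n],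
     on which the powers below rely. *)
  destruct (Nat.eq_dec n 0) as [->|Hn].
  - exists 1%nat, (fun _ => 1%nat). split; [|lia]. split; [lia|].
    intros e He. destruct (HU e He) as (_ & Hlen & Hv).
    destruct e as [|v e]; [simpl in Hlen; lia|]. specialize (Hv v (or_introl eq_refl)). lia.
  - destruct d as [|[|q]]; try lia. replace (S (S q) - 1)%nat with (S q) in * by lia.
    (* There will be [S k = d - l + 2] blocks and [S s = l - 2] simplex vertices; [w] is chosen so
       that [w ^ (3 ^ k)] equals [n]. *)
    set (k := (S (S q) + 1 - l)%nat) in *. set (s := (l - 3)%nat).
    set (w := Rpower (INR n) eps).
    assert (Hn0 : (0 < n)%nat) by lia.
    assert (Hn1 : 1 <= INR n) by (apply (le_INR 1); lia).
    assert (H3 : 0 < 3 ^ k) by (apply pow_lt; lra).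
    assert (Heps : 0 < eps) by now apply Rinv_0_lt_compat.
    assert (Hw : 1 <= w).
    { unfold w. rewrite <- (Rpower_O (INR n)) by lra. apply Rle_Rpower; lra. }
    assert (Hwn : w ^ Nat.pow 3 k <= INR n).
    { unfold w. rewrite <- Rpower_pow by apply exp_pos.
      rewrite Rpower_mult, pow_INR. replace (INR 3) with 3 by (simpl; ring).
      unfold eps. rewrite Rinv_l, Rpower_1; lra. }
    destruct (Z_of_nat_complete (Rceil X)) as [[|c] Hc]; try lia.
    exists (S c).
    assert (HcR : X <= INR (S c)) by (rewrite INR_IZR_INZ, <- Hc; exact HcX).
    assert (HXw : X ^ S q * w = exp 1 * INR (S (S q)) * INR n ^ S q).
    { apply coloring_number_pow; try lia.
      apply Rmult_lt_0_compat; [apply exp_pos|apply lt_0_INR; lia]. }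
    destruct (Extremal.join_or_weak_coloring (n := n) (s := s) (k := k) (q := q) (c := c) (E := E) (w := w))
      as [(g & Hg & HE)|[kappa Hk]].
    + lia.
    + unfold s, k. lia.
    + exact HU.
    + exact Hw.
    + exact Hwn.
    + replace (INR 4) with 4 by (simpl; ring).
      (* The power of [X] times [w] is known exactly by [HXw]; the passage from [X] to the integer
         [S c] comes last. *)
      apply Rle_trans with (X ^ S q * w * (INR q ^ q * INR (Factorial.fact (S q)))).
      * rewrite HXw. pose proof (rosenfeld_constant q ltac:(lia)) as H4.
        replace (4 * INR n ^ S q * INR (S q) ^ S q) with (INR n ^ S q * (4 * INR (S q) ^ S q)) by ring.
        replace (exp 1 * INR (S (S q)) * INR n ^ S q * (INR q ^ q * INR (Factorial.fact (S q))))
          with (INR n ^ S q * (exp 1 * INR (S (S q)) * (INR q ^ q * INR (Factorial.fact (S q))))) by ring.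
        apply Rmult_le_compat_l; [apply pow_le; lra|exact H4].
      * rewrite (Rmult_comm (X ^ S q)), Rmult_assoc. apply Rmult_le_compat_l; [lra|].
        rewrite Rmult_assoc. apply Rmult_le_compat_r.
        -- apply Rmult_le_pos; [apply pow_le, pos_INR|apply pos_INR].
        -- apply pow_incr. lra.
    + exfalso. apply (PL_embeddable_no_join (2 * S (S q) - l) (S (S q)) n E (S k) (S s) g); auto.
      unfold s, k. lia.
    + exists kappa. split; [exact Hk|]. rewrite Hc. lia.
Qed.
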